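(* Given an instance with goods and identical valuations (all agents have the same value function $v$ on items and the same quantile $\tau$), an allocation (with no balancedness constraint) of maximum egalitarian social welfare can be computed in polynomial time.
   Context: There is a set $N$ of $n$ agents and a set $M$ of $m$ indivisible items; every agent has value $v(g)\ge 0$ for item $g$ and quantile $\tau\in[0,1]$. For a nonempty bundle $S\subseteq M$, order its items as $g_1,\dots,g_{|S|}$ with $v(g_1)\le\dots\le v(g_{|S|})$; then $v(S)=v(g_{\lceil \tau|S|\rceil})$ if $\tau>0$ and $v(S)=v(g_1)$ if $\tau=0$. An allocation is an $n$-partition $A=(A_1,\dots,A_n)$ of $M$. $\mathrm{ESW}(A)=\min_{i\in N}v(A_i)$. *)

(* Defs.v *)
From mathcomp Require Import all_boot all_order all_algebra.
Set Implicit Arguments. Unset Strict Implicit. Unset Printing Implicit Defensive.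
Import Order.TTheory GRing.Theory Num.Theory.

(* Items are 0..m-1, agents are 0..n-1.  The common value function is  *)
(* given by the sequence [vals] (vals`_g = v(g) >= 0), the common       *)
(* quantile is [tau] in [0,1].  An allocation is a sequence [A] of      *)
(* size m with A`_g < n: item g goes to agent A`_g (so the bundles form *)
(* an n-partition of M; bundles may be empty).                          *)

Local Open Scope ring_scope.

(* the (1-based) rank of the quantile item in a bundle of size s *)
Definition qrank (tau : rat) (s : nat) : nat :=
  if 0 < tau then `|Num.ceil (tau * s%:R)|%N else 1%N.

(* quantile value of a bundle given by the multiset of its item values:
   the qrank-th smallest value.  For the empty bundle this is 0
   (convention; the paper only defines v on nonempty bundles). *)
Definition qval (tau : rat) (S : seq rat) : rat :=
  nth 0 (sort <=%R S) (qrank tau (size S)).-1.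

Definition bundle_vals (vals : seq rat) (A : seq nat) (i : nat) : seq rat :=
  [seq vals`_g | g <- iota 0 (size A) & nth 0%N A g == i].

Definition bundle_value (vals : seq rat) (tau : rat) (A : seq nat) (i : nat) : rat :=
  qval tau (bundle_vals vals A i).

Definition is_allocation (n m : nat) (A : seq nat) : bool :=
  (size A == m) && all (fun i => (i < n)%N) A.

(* ESW(A) = min_{i in N} v(A_i)  (n >= 1 assumed where used) *)
Definition ESW (n : nat) (vals : seq rat) (tau : rat) (A : seq nat) : rat :=
  foldr Num.min (bundle_value vals tau A 0)
        [seq bundle_value vals tau A i | i <- iota 0 n].

Definition max_ESW_allocation (n m : nat) (vals : seq rat) (tau : rat)
    (A : seq nat) : Prop :=
  is_allocation n m A /\
  forall B, is_allocation n m B -> ESW n vals tau B <= ESW n vals tau A.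

Local Close Scope ring_scope.

(* A unit-cost RAM whose only arithmetic is addition and truncated      *)
(* subtraction (plus direct/indirect memory access and a conditional   *)
(* jump); such a RAM is polynomially equivalent to Turing machines     *)
(* under the bit-length input measure.                                 *)

Inductive instr : Type :=
| IConst of nat & nat
| IAdd of nat & nat & nat
| ISub of nat & nat & nat
| ILoad of nat & nat
| IStore of nat & nat
| IJle of nat & nat & nat
| IHalt.

Definition program := seq instr.
Definition memory := nat -> nat.

Definition upd (M : memory) (a v : nat) : memory :=
  fun x => if x == a then v else M x.

Definition step (P : program) (pc : nat) (M : memory) : option (nat * memory) :=
  match nth IHalt P pc with
  | IConst d c => Some (pc.+1, upd M d c)
  | IAdd a b d => Some (pc.+1, upd M d (M a + M b))
  | ISub a b d => Some (pc.+1, upd M d (M a - M b))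
  | ILoad a d => Some (pc.+1, upd M d (M (M a)))
  | IStore a d => Some (pc.+1, upd M (M d) (M a))
  | IJle a b l => Some (if M a <= M b then l else pc.+1, M)
  | IHalt => None
  end.

Fixpoint run (P : program) (t : nat) (pc : nat) (M : memory) : option memory :=
  match step P pc M with
  | None => Some M
  | Some (pc', M') => if t is t'.+1 then run P t' pc' M' else None
  end.

Definition init_mem (inp : seq nat) : memory :=
  fun x => if x is x'.+1 then nth 0 inp x' else size inp.

Definition read_output (M : memory) : seq nat :=
  [seq M i.+1 | i <- iota 0 (M 0)].

Definition runs_within (P : program) (inp : seq nat) (t : nat) (out : seq nat) : Prop :=
  exists M, run P t 0 (init_mem inp) = Some M /\ read_output M = out.

Definition bitlen (x : nat) : nat := (trunc_log 2 x).+1.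
Definition input_size (inp : seq nat) : nat := \sum_(x <- inp) bitlen x.

Definition encode_instance (n m p q : nat) (a b : seq nat) : seq nat :=
  [:: n; m; p; q] ++ flatten [seq [:: nth 0 a j; nth 0 b j] | j <- iota 0 m].

Definition rat_vals (a b : seq nat) : seq rat :=
  [seq ((nth 0%N a j)%:R / (nth 0%N b j)%:R)%R | j <- iota 0 (size a)].

Definition rat_tau (p q : nat) : rat := ((p%:R) / (q%:R))%R.

(* Main.v *)
Require Import Defs.
From mathcomp Require Import all_boot all_order all_algebra.
From mathcomp Require Import zify.
Set Implicit Arguments. Unset Strict Implicit. Unset Printing Implicit Defensive.

(* Fix a threshold and call an item good if its value reaches it.  A bundle of
   size s >= 1 reaches the threshold iff at most qrank(s) - 1 of its items are
   bad.  So all bundles can reach the threshold iff at least H items are good,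
   where m - H is the maximum of the sum of qrank(s_i) - 1 over the partitions
   of m into n positive sizes s_i; this number does not depend on the
   threshold, and the optimum is the value of the H-th best item.  The sizes
   s_i are found by dynamic programming; the H best items serve as the good
   ones and the others as the bad ones.  If m < n, some bundle is empty and all
   allocations have welfare 0.

   Products are computed by repeated doubling, and items are ranked by
   comparing each pair of values a_i / b_i and a_j / b_j via a_i * b_j and
   a_j * b_i, which takes polynomial time although the RAM cannot multiply. *)

(** * Structured programs over the RAM *)

(** Why thresholds disappear: the upper bound only counts. If every bundle exceeds the value of some
    item, at most [m - H] items fail to exceed it. Conversely, giving each agent as many of the
    worst items as the size of its bundle tolerates keeps all bundles at or above the H-th best
    item. Both arguments depend on ranks alone, so one allocation settles the optimum without any
    search over thresholds. Numbers are given in binary, so [n] may be exponential in the input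
    size; no loop may run over the agents before [n <= m] has been tested. After that, [m] bounds
    every loop over agents or items, and it is small because each item contributes two numbers to
    the input. A single number [X] thus bounds the rounds of every loop, and the degree of the
    running time is the nesting depth of the loops. The machine shapes the rest: it has no registers
    besides its memory, and input and output both start at cell 0, so the data must be moved away to
    free working cells and moved back at the end. There is no division either, so the rounded
    quotients are updated from one bundle size to the next. *)

Inductive cmd : Type :=
| Skip
| Op of instr
| Seq of cmd & cmd
| If of nat & nat & cmd & cmd
| While of nat & nat & cmd.

Fixpoint csize (c : cmd) : nat :=
  match c with
  | Skip => 0
  | Op _ => 1
  | Seq c1 c2 => csize c1 + csize c2
  | If _ _ c1 c2 => csize c1 + csize c2 + 2
  | While _ _ c1 => csize c1 + 2
  end.

(* [If a b c1 c2] branches on M a <= M b, [While a b c] loops while M a < M b;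
   [IJle 0 0] is the unconditional jump. *)
Fixpoint compile (o : nat) (c : cmd) : seq instr :=
  match c with
  | Skip => [::]
  | Op i => [:: i]
  | Seq c1 c2 => compile o c1 ++ compile (o + csize c1) c2
  | If a b c1 c2 =>
      let o1 := o + csize c2 + 2 in
      IJle a b o1 :: compile o.+1 c2 ++
      IJle 0 0 (o1 + csize c1) :: compile o1 c1
  | While a b c1 =>
      IJle b a (o + csize c1 + 2) :: compile o.+1 c1 ++ [:: IJle 0 0 o]
  end.

(* Worst-case running time when every loop makes at most [X] iterations. *)
Fixpoint cost (X : nat) (c : cmd) : nat :=
  match c with
  | Skip => 0
  | Op _ => 1
  | Seq c1 c2 => cost X c1 + cost X c2
  | If _ _ c1 c2 => cost X c1 + cost X c2 + 2
  | While _ _ c1 => X * (cost X c1 + 2) + 1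
  end.

(** For a loop, the summand 3 pays for the two jumps of each round and for the last test. *)
Fixpoint cost_coeff (c : cmd) : nat :=
  match c with
  | Skip => 0
  | Op _ => 1
  | Seq c1 c2 => cost_coeff c1 + cost_coeff c2
  | If _ _ c1 c2 => cost_coeff c1 + cost_coeff c2 + 2
  | While _ _ c1 => cost_coeff c1 + 3
  end.

Fixpoint loop_depth (c : cmd) : nat :=
  match c with
  | Skip | Op _ => 0
  | Seq c1 c2 | If _ _ c1 c2 => maxn (loop_depth c1) (loop_depth c2)
  | While _ _ c1 => (loop_depth c1).+1
  end.

Lemma cost_poly X c : 0 < X -> cost X c <= cost_coeff c * X ^ loop_depth c.
Proof.
move=> X0; elim: c => //= [c1 IH1 c2 IH2|_ _ c1 IH1 c2 IH2|_ _ c IH].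
- rewrite mulnDl leq_add // (leq_trans IH1, leq_trans IH2) // leq_mul2l;
  by rewrite leq_pexp2l ?orbT // (leq_maxl, leq_maxr).
- rewrite !mulnDl leq_add //; last by rewrite leq_pmulr // expn_gt0 X0.
  rewrite leq_add // (leq_trans IH1, leq_trans IH2) // leq_mul2l;
  by rewrite leq_pexp2l ?orbT // (leq_maxl, leq_maxr).
- have E0 : 0 < X ^ loop_depth c by rewrite expn_gt0 X0.
  rewrite expnS; move: (X ^ _) E0 IH => E E0 IH.
  apply: (@leq_trans (X * (cost_coeff c * E + 2) + 1)).
    by rewrite leq_add2r leq_mul2l leq_add2r IH orbT.
  have : 0 < X * E by rewrite muln_gt0 X0.
  have : X <= X * E by rewrite leq_pmulr.
  nia.
Qed.

Lemma size_compile c o : size (compile o c) = csize c.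
Proof.
elim: c o => //= [c1 IH1 c2 IH2|_ _ c1 IH1 c2 IH2|_ _ c IH] o;
  rewrite ?size_cat /= ?IH1 ?IH2 ?IH /=; lia.
Qed.

(** Unlike [run], which answers only after a halt, this keeps the program counter after exactly [t]
    instructions, so that executions can be concatenated. *)
Fixpoint steps (P : program) (t pc : nat) (M : memory) : option (nat * memory) :=
  if t is t'.+1 then
    if step P pc M is Some (pc', M') then steps P t' pc' M' else None
  else Some (pc, M).

Lemma steps_cat P t1 t2 pc M pc' M' :
  steps P t1 pc M = Some (pc', M') ->
  steps P (t1 + t2) pc M = steps P t2 pc' M'.
Proof.
elim: t1 pc M => [|t1 IH] pc M /=; first by case=> -> ->.
by case: step => // -[pc1 M1] /IH.
Qed.

(** Leaving the code at its end is a halt, because reading an instruction there yields the default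
    [IHalt]. *)
Lemma steps_run P t pc M pc' M' :
  steps P t pc M = Some (pc', M') -> size P <= pc' -> run P t pc M = Some M'.
Proof.
elim: t pc M => [|t IH] pc M /=.
  by case=> -> -> h; rewrite /step nth_default.
by case: step => // -[pc1 M1] /IH.
Qed.

Definition code_at (P : program) (o : nat) (s : seq instr) : Prop :=
  forall k, k < size s -> nth IHalt P (o + k) = nth IHalt s k.

Lemma code_at_catl P o s1 s2 : code_at P o (s1 ++ s2) -> code_at P o s1.
Proof.
move=> H k ks; rewrite H ?nth_cat ?ks // size_cat; lia.
Qed.

Lemma code_at_catr P o s1 s2 :
  code_at P o (s1 ++ s2) -> code_at P (o + size s1) s2.
Proof.
move=> H k ks; rewrite -addnA H ?size_cat ?ltn_add2l // nth_cat.
by rewrite ltnNge leq_addr /= addKn.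
Qed.

Lemma code_at_cons P o i s :
  code_at P o (i :: s) -> nth IHalt P o = i /\ code_at P o.+1 s.
Proof.
move=> H; split; first by rewrite -[o]addn0 H.
by move=> k ks; rewrite addSnnS H.
Qed.

Definition effect (i : instr) (M : memory) : memory :=
  match i with
  | IConst d c => upd M d c
  | IAdd a b d => upd M d (M a + M b)
  | ISub a b d => upd M d (M a - M b)
  | ILoad a d => upd M d (M (M a))
  | IStore a d => upd M (M d) (M a)
  | _ => M
  end.

Definition straight (i : instr) : bool :=
  match i with IJle _ _ _ | IHalt => false | _ => true end.

(** Total correctness with a time bound. Jumps are absolute, so the host program [P] and the offset
    [o] are quantified; each piece of code can then be verified on its own. *)
Definition wp (X : nat) (c : cmd) (Q : memory -> Prop) (M : memory) : Prop :=
  forall P o, code_at P o (compile o c) ->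
  exists t M', [/\ t <= cost X c, steps P t o M = Some (o + csize c, M') & Q M'].

Section Wp.
Variable X : nat.
Implicit Types (M : memory) (Q : memory -> Prop).

Lemma wp_conseq c Q Q' M :
  wp X c Q M -> (forall M', Q M' -> Q' M') -> wp X c Q' M.
Proof.
move=> H HQ P o /H [t [M' [h1 h2 h3]]]; exists t, M'; split=> //; exact: HQ.
Qed.

Lemma wp_skip Q M : Q M -> wp X Skip Q M.
Proof. by move=> H P o _; exists 0, M; rewrite /= addn0. Qed.

Lemma wp_op i Q M : straight i -> Q (effect i M) -> wp X (Op i) Q M.
Proof.
move=> si H P o /code_at_cons [E _]; exists 1, (effect i M); split=> //.
by rewrite /= /step E addn1; case: i si {H E}.
Qed.

Lemma wp_seq c1 c2 Q M : wp X c1 (wp X c2 Q) M -> wp X (Seq c1 c2) Q M.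
Proof.
move=> H P o /= /[dup] /code_at_catl /H [t1 [M1 [h1 h2 h3]]] /code_at_catr.
rewrite size_compile => /h3 [t2 [M2 [k1 k2 k3]]].
exists (t1 + t2), M2; split=> //; first exact: leq_add.
by rewrite (steps_cat _ h2) k2 addnA.
Qed.

Lemma wp_if a b c1 c2 Q M :
  (M a <= M b -> wp X c1 Q M) -> (M b < M a -> wp X c2 Q M) ->
  wp X (If a b c1 c2) Q M.
Proof.
move=> H1 H2 P o /code_at_cons [E /[dup] /code_at_catl C2 /code_at_catr].
rewrite size_compile => /code_at_cons [E' C1].
have eo : (o.+1 + csize c2).+1 = o + csize c2 + 2 by lia.
rewrite eo in C1; case: (leqP (M a) (M b)) => h.
  have [t [M' [k1 k2 k3]]] := H1 h P _ C1.
  exists t.+1, M'; split=> //; first by rewrite /=; lia.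
  rewrite /= /step E h k2; congr (Some (_, _)); lia.
have [t [M' [k1 k2 k3]]] := H2 h P _ C2.
exists (1 + (t + 1)), M'; split=> //; first by rewrite /=; lia.
rewrite add1n /= {1}/step E leqNgt h /= (steps_cat _ k2) /= /step E' leqnn.
congr (Some (_, _)); lia.
Qed.

(** Induction on the rounds left in the budget [X]. The invariant is indexed by the rounds done and
    must imply [i < X] whenever the guard holds, so an exhausted budget forces the exit. *)
Lemma wp_while a b c (I : nat -> memory -> Prop) Q M :
  I 0 M ->
  (forall i M', I i M' -> M' a < M' b -> i < X /\ wp X c (I i.+1) M') ->
  (forall i M', I i M' -> M' b <= M' a -> Q M') ->
  wp X (While a b c) Q M.
Proof.
move=> I0 Istep IQ P o C.
have /code_at_cons [E /[dup] /code_at_catl Cc /code_at_catr] := C.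
rewrite size_compile => /code_at_cons [E' _].
suff: forall k i M1, i + k = X -> I i M1 -> exists t M',
  [/\ t <= k * (cost X c + 2) + 1,
      steps P t o M1 = Some (o + csize (While a b c), M') & Q M'].
  by move=> /(_ X 0 M (add0n X) I0).
elim=> [|k IH] i M1 ik Ii; case: (leqP (M1 b) (M1 a)) => h.
- exists 1, M1; split=> //=; last exact: IQ Ii h.
  by rewrite /step E h; congr (Some (_, _)); lia.
- by have [] := Istep _ _ Ii h; lia.
- exists 1, M1; split=> //=; [lia | | exact: IQ Ii h].
  by rewrite /step E h; congr (Some (_, _)); lia.
have [iX /(_ P _ Cc) [t [M2 [h1 h2 h3]]]] := Istep _ _ Ii h.
have [|t' [M3 [k1 k2 k3]]] := IH i.+1 M2 _ h3; first lia.
exists (1 + (t + (1 + t'))), M3; split=> //; first by rewrite mulSn; lia.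
rewrite add1n /= {1}/step E leqNgt h /= (steps_cat _ h2) add1n /= {1}/step.
by rewrite E' leqnn /= k2.
Qed.

Lemma wp_for a b N c (I : nat -> memory -> Prop) Q M :
  N <= X ->
  I 0 M ->
  (forall i M', I i M' -> i <= N -> M' a = i /\ M' b = N) ->
  (forall i M', I i M' -> i < N -> wp X c (I i.+1) M') ->
  (forall M', I N M' -> Q M') ->
  wp X (While a b c) Q M.
Proof.
move=> NX I0 Iab Ic IQ.
apply: (@wp_while a b c (fun i M' => i <= N /\ I i M')); first by [].
- move=> i M' [iN /[dup] Ii /Iab /(_ iN) [-> ->]] lt; split; first lia.
  by apply: wp_conseq (Ic _ _ Ii lt) _.
- move=> i M' [iN /[dup] Ii /Iab /(_ iN) [-> ->]] le.
  by apply: IQ; rewrite (_ : N = i) //; lia.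
Qed.

End Wp.

Definition block (s : seq cmd) : cmd := foldr Seq Skip s.

Arguments upd _ _ _ _ /.

(** * Multiplication *)

(* After [setup_cmd] cells 20 to 31 hold n, m, p, q, the addresses of the items,
   of the output, of the list of owners and of the dynamic programming table,
   m - n + 1, q - p, 0 and 1, see [env]; cells 0 to 17 are temporaries. *)
Definition mul_cmd : cmd :=
  block [:: Op (IConst 2 0);
    While 30 0 (block [::
      Op (IConst 3 1); Op (IAdd 1 30 4); Op (IAdd 3 3 5); Op (IAdd 0 31 6);
      While 5 6 (block [::
        Op (IAdd 3 3 3); Op (IAdd 4 4 4); Op (IAdd 3 3 5)]);
      Op (ISub 0 3 0); Op (IAdd 2 4 2)])].

Ltac op := apply: wp_seq; apply: wp_op => //=.
Ltac unupd := rewrite /upd; repeat (case: eqP => [?|_]; first (exfalso; lia)).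

Lemma leq_bitlen k x : 2 ^ k <= x -> k < bitlen x.
Proof.
by move=> h; rewrite ltnS trunc_log_max.
Qed.

(** There are no shifts, so [x] is consumed from its leading bit: the inner loop doubles 1 and [y]
    side by side until the largest power of two not above the rest of [x] is found. Both loops run
    at most [bitlen x] times. *)
Lemma wp_mul X M x y Q :
  M 0 = x -> M 1 = y -> M 30 = 0 -> M 31 = 1 -> bitlen x <= X ->
  (forall M', M' 2 = x * y -> (forall z, 7 <= z -> M' z = M z) -> Q M') ->
  wp X mul_cmd Q M.
Proof.
move=> Mx My M30 M31 xX HQ; rewrite /mul_cmd /block /=; op.
apply: wp_seq; apply: (@wp_while _ _ _ _ (fun i M' => [/\ M' 0 * 2 ^ i <= x,
  M' 2 + M' 0 * y = x * y, M' 1 = y & forall z, 7 <= z -> M' z = M z])).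
- rewrite /= Mx My muln1; split=> // z hz; by unupd.
- move=> i M1 [h1 h2 h3 h4]; rewrite (h4 30) // M30 => x0; split.
    apply: leq_trans xX; apply: leq_bitlen; nia.
  op; op; op; op.
  rewrite h3 (h4 30) // (h4 31) // M30 M31 addn0.
  set M2 := upd _ _ _; have M26 : M2 6 = (M1 0).+1 by rewrite /M2 /= addn1.
  apply: wp_seq; apply: (@wp_while _ _ _ _ (fun k M' => [/\ M' 3 = 2 ^ k,
     M' 4 = 2 ^ k * y, M' 5 = 2 ^ k.+1, M' 3 <= M1 0 &
     forall z, z \notin [:: 3; 4; 5] -> M' z = M2 z])).
  + rewrite /= mul1n; split=> //.
  + move=> k M3 [k1 k2 k3 k4 k5]; rewrite k3 (k5 6) // M26 ltnS => lt; split.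
      apply: leq_trans xX; apply: leq_bitlen.
      apply: (leq_trans (n := 2 ^ k.+1)); first by rewrite leq_pexp2l.
      by apply: leq_trans lt _; apply: leq_trans h1; rewrite leq_pmulr ?expn_gt0.
    op; op; op; apply: wp_skip => /=; rewrite k1 k2 !expnS; rewrite expnS in lt.
    split; try lia.
    move=> z /[dup] hz; rewrite !inE => /norP [? /norP [? ?]].
    by unupd; apply: k5.
  + move=> k M3 [k1 k2 k3 k4 k5]; rewrite k3 (k5 6) // M26 => lt.
    op; op; apply: wp_skip => /=; rewrite !(k5 0) // !(k5 1) // !(k5 2) //.
    have [-> [-> ->]] : M2 0 = M1 0 /\ M2 1 = M1 1 /\ M2 2 = M1 2 by [].
    rewrite k1 k2; rewrite k1 in k4; rewrite expnS in lt.
    split => //.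
    (* The rest is below [2 ^ k.+1], so removing [2 ^ k] at least halves it. *)
    * by rewrite expnS mulnA; apply: leq_trans h1; rewrite leq_mul2r; lia.
    * by rewrite -h2 -addnA -mulnDl subnKC.
    * move=> z hz; unupd; rewrite k5 /M2; first by unupd; apply: h4.
      rewrite !inE; lia.
- move=> i M1 [h1 h2 h3 h4]; rewrite (h4 30) // M30 leqn0 => /eqP E.
  apply: wp_skip; apply: HQ => //; by rewrite -h2 E; lia.
Qed.

(** * Ranking the items *)

Lemma wp_when_add X a b s d Q M :
  (forall M', M' d = M d + (M a <= M b) * M s ->
              (forall z, z != d -> M' z = M z) -> Q M') ->
  wp X (If a b (Op (IAdd d s d)) Skip) Q M.
Proof.
move=> H; apply: wp_if => h.
  apply: wp_op => //; apply: H => /= [|z /negbTE ->] //.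
  by rewrite eqxx h mul1n.
by apply: wp_skip; apply: H => //; rewrite leqNgt h addn0.
Qed.

Lemma wp_store X a d x Q M :
  M d = x ->
  (forall M', M' x = M a -> (forall z, z != x -> M' z = M z) -> Q M') ->
  wp X (Op (IStore a d)) Q M.
Proof.
move=> <- H; apply: wp_op => //; apply: H => /= [|z /negbTE ->] //.
by rewrite eqxx.
Qed.

(* Item [i] precedes item [j] in the order by decreasing value, ties being
   broken by index. *)
Definition before (a b : seq nat) (i j : nat) : bool :=
  nth 0 a j * nth 0 b i + (j <= i) <= nth 0 a i * nth 0 b j.

Definition rank (a b : seq nat) (m j : nat) : nat :=
  count (fun i => before a b i j) (iota 0 m).

(** The first conditional adds the tie-breaking unit to the left side of [before], the second
    compares the two sides and counts. *)
Definition rank_loop : cmd :=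
  While 7 21 (block [::
    Op (ILoad 8 0); Op (IAdd 15 30 1); mul_cmd; Op (IAdd 2 30 10);
    Op (IAdd 8 31 11); Op (ILoad 11 0); Op (IAdd 14 30 1); mul_cmd;
    If 12 7 (Op (IAdd 2 31 2)) Skip;
    If 2 10 (Op (IAdd 9 31 9)) Skip;
    Op (IAdd 7 31 7); Op (IAdd 11 31 8)]).

Definition output_cmd : cmd :=
  block [:: Op (IAdd 24 30 13); Op (IAdd 25 30 16); Op (IConst 12 0);
    While 12 21 (block [::
      Op (ILoad 13 14); Op (IAdd 13 31 11); Op (ILoad 11 15);
      Op (IConst 9 0); Op (IConst 7 0); Op (IAdd 24 30 8);
      rank_loop;
      Op (IAdd 26 9 11); Op (ILoad 11 0); Op (IStore 0 16);
      Op (IAdd 16 31 16); Op (IAdd 13 31 13); Op (IAdd 13 31 13);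
      Op (IAdd 12 31 12)])].

Section Output.
Variables (X m base : nat) (a b : seq nat).
Hypotheses (m_le_X : m <= X) (base_ge : 32 <= base).
Hypothesis a_le_X : forall j, j < m -> bitlen (nth 0 a j) <= X.
Hypothesis b_le_X : forall j, j < m -> bitlen (nth 0 b j) <= X.

Definition items_at (M : memory) : Prop := forall j, j < m ->
  M (base + j.*2) = nth 0 a j /\ M (base + j.*2).+1 = nth 0 b j.

Lemma wp_rank_loop M j Q :
  M 30 = 0 -> M 31 = 1 -> M 21 = m -> M 7 = 0 -> M 8 = base -> M 9 = 0 ->
  M 12 = j -> M 14 = nth 0 a j -> M 15 = nth 0 b j -> items_at M ->
  (forall M', M' 9 = rank a b m j -> (forall z, 12 <= z -> M' z = M z) ->
     Q M') ->
  wp X rank_loop Q M.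
Proof.
move=> M30 M31 M21 M7 M8 M9 M12 M14 M15 itM HQ.
apply: (@wp_for _ _ _ m _ (fun i M' => [/\ M' 7 = i, M' 8 = base + i.*2,
  M' 9 = count (fun i => before a b i j) (iota 0 i) &
  forall z, 12 <= z -> M' z = M z])) => //.
- by rewrite M7 M8 M9 addn0.
- by move=> i M1 [h1 _ _ h4] _; rewrite (h4 21) ?M21.
- move=> i M1 [h1 h2 h3 h4] im; rewrite /block /=.
  have [ai bi] : M1 (base + i.*2) = nth 0 a i /\ M1 (base + i.*2).+1 = nth 0 b i.
    by have [] := itM _ im; rewrite !h4 //; lia.
  have [e12 e14 e15 e30 e31] : [/\ M1 12 = j, M1 14 = nth 0 a j,
    M1 15 = nth 0 b j, M1 30 = 0 & M1 31 = 1] by rewrite !h4.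
  op; op; apply: wp_seq; rewrite h2 e15 e30 addn0 ai.
  apply: wp_mul => //=; first exact: a_le_X.
  move=> M2 M22 hM2.
  have E2 z : 7 <= z -> M2 z = M1 z by move=> hz; rewrite hM2 //; unupd.
  op; op; op; op; apply: wp_seq.
  rewrite !(E2 8) // !(E2 14) // !(E2 30) // !(E2 31) //.
  rewrite h2 e30 e31 M22 e14 !addn0 !addn1.
  (* Item addresses are at least 32, so they differ from the temporaries just written. *)
  have -> : (if (base + i.*2).+1 == 11 then (base + i.*2).+1 else
     if (base + i.*2).+1 == 10 then nth 0 a i * nth 0 b j
     else M2 (base + i.*2).+1) = nth 0 b i.
    by rewrite !ifN_eq ?E2 ?bi //; lia.
  apply: wp_mul => //=; rewrite ?(E2 30) ?(E2 31) //; first exact: b_le_X.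
  move=> M3 M32 hM3.
  apply: wp_seq; apply: wp_when_add => M4 M42 hM4.
  apply: wp_seq; apply: wp_when_add => M5 M59 hM5.
  have E z : 7 <= z -> z \notin [:: 9; 10; 11] -> M5 z = M1 z.
    rewrite !inE => hz /norP [z9 /norP [z10 z11]].
    rewrite hM5 // hM4 ?hM3 //=; last by lia.
    by rewrite -E2 //; unupd.
  op; op; apply: wp_skip => /=.
  rewrite !(E 7) // !(E 31) // h1 e31 addn1; split=> //.
  + rewrite hM5 // hM4 // hM3 //=; lia.
  + rewrite M59 M42 (hM4 9) // (hM4 10) // (hM4 31) // M32.
    rewrite (hM3 7) // (hM3 9) // (hM3 10) // (hM3 12) // (hM3 31) //=.
    rewrite !(E2 7) // !(E2 12) // !(E2 31) // (E2 9) // h1 h3 e12 e31 !muln1.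
    rewrite -[RHS]/(count _ (iota 0 i.+1)) -(addn1 i) iotaD count_cat /= addn0.
    by rewrite /before (mulnC (nth 0 b i)).
  + by move=> z hz; unupd; rewrite E ?h4 // ?inE; lia.
- by move=> M1 [_ _ h3 h4]; apply: HQ.
Qed.

Lemma wp_output M out own Q :
  M 30 = 0 -> M 31 = 1 -> M 21 = m -> M 24 = base -> M 25 = out ->
  M 26 = own -> items_at M -> base + m.*2 <= out -> out + m <= own ->
  (forall M', (forall j, j < m -> M' (out + j) = M (own + rank a b m j)) ->
     (forall z, 17 <= z -> (z < out) || (out + m <= z) -> M' z = M z) ->
     Q M') ->
  wp X output_cmd Q M.
Proof.
move=> M30 M31 M21 M24 M25 M26 itM outE ownE HQ; rewrite /output_cmd /block /=.
op; op; op; apply: wp_seq.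
apply: (@wp_for _ _ _ m _ (fun j M' => [/\ M' 12 = j, M' 13 = base + j.*2,
  M' 16 = out + j,
  forall i, i < j -> M' (out + i) = M (own + rank a b m i) &
  forall z, 17 <= z -> (z < out) || (out + j <= z) -> M' z = M z])) => //.
- by rewrite /= M24 M25 M30 !addn0; split=> // z hz _; unupd.
- by move=> j M1 [h1 _ _ _ h5] _; rewrite (h5 21) // ?M21 //; lia.
- move=> j M1 [h1 h2 h3 h4 h5] jm.
  have h5' z : 17 <= z < out -> M1 z = M z by move=> hz; apply: h5; lia.
  have it1 : items_at M1.
    by move=> k km; have [? ?] := itM _ km; rewrite !h5' //; lia.
  have [aj bj] := it1 _ jm.
  have [e21 e24 e26 e30 e31] : [/\ M1 21 = m, M1 24 = base, M1 26 = own,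
    M1 30 = 0 & M1 31 = 1] by rewrite !h5' //; lia.
  op; op; op; op; op; op; rewrite h2 e24 e30 e31 addn0 addn1 aj.
  have -> : (if (base + j.*2).+1 == 11 then (base + j.*2).+1 else
     if (base + j.*2).+1 == 14 then nth 0 a j else M1 (base + j.*2).+1)
     = nth 0 b j by rewrite !ifN_eq ?bj //; lia.
  apply: wp_seq; apply: (@wp_rank_loop _ j) => //=.
    by move=> k km; split; unupd; have [] := it1 _ km.
  move=> M2 M29 hM2.
  have E z : 12 <= z -> z != 14 -> z != 15 -> M2 z = M1 z.
    by move=> hz z1 z2; rewrite hM2 //=; unupd.
  op; op; rewrite E // e26 M29.
  have -> : (if own + rank a b m j == 11 then own + rank a b m j
     else M2 (own + rank a b m j)) = M (own + rank a b m j).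
    by rewrite ifN_eq ?E ?h5 //; lia.
  apply: wp_seq; apply: (@wp_store _ _ _ (out + j)); rewrite /= ?E // => M3 M3x hM3.
  have E3 z : 12 <= z -> z != 14 -> z != 15 -> z != out + j -> M3 z = M1 z.
    by move=> hz z14 z15 zx; rewrite hM3 //; unupd; apply: E.
  op; op; op; op; apply: wp_skip => /=.
  rewrite (E3 12) ?(E3 13) ?(E3 16) ?(E3 31); try lia.
  rewrite h1 h2 h3 e31 !addn1; split; try lia.
  + move=> i; rewrite ltnS leq_eqVlt => /predU1P [-> | ij]; unupd => //.
    by rewrite E3 ?h4 //; lia.
  + by move=> z hz hz2; unupd; rewrite E3 ?h5 //; lia.
- by move=> M1 [h1 h2 h3 h4 h5]; apply: wp_skip; apply: HQ.
Qed.

End Output.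

(** * Optimal bundle sizes *)

(* [gain t] is one less than the rank of the quantile item in a bundle of size
   [t.+1], i.e. the number of items of such a bundle that may be bad. *)
Definition gain (p q t : nat) : nat := (p * t.+1).-1 %/ q.

(* Largest total gain of [i.+1] nonempty bundles with [i.+1 + j] items in all. *)
Fixpoint opt (p q i j : nat) : nat :=
  if i is i'.+1 then \max_(t < j.+1) (opt p q i' (j - t) + gain p q t)
  else gain p q j.

(** Here [d] is the slack up to the next multiple of [q]: [d < q] says that [c.+1] is [p * t.+1 / q]
    rounded up. For [p = 0] the slack is all of [q], hence the separate case. *)
Lemma gain_eq p q t c d :
  d + p * t.+1 = c.+1 * q -> d < q \/ p = 0 /\ c = 0 -> gain p q t = c.
Proof.
rewrite /gain => E [dq | [-> ->]]; last by rewrite mul0n div0n.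
have [p0 | p0] := posnP p; first by rewrite p0 mul0n mulSn in E; lia.
rewrite (_ : (p * t.+1).-1 = c * q + (q - d).-1); last by rewrite mulSn in E; lia.
rewrite divnMDl; last lia.
by rewrite divn_small ?addn0 //; lia.
Qed.

(** A quantile of at most 1 never points past the end of a bundle; so every nonempty bundle needs at
    least one good item. *)
Lemma gain_le p q t : 0 < q -> p <= q -> gain p q t <= t.
Proof.
move=> q0 p_le_q; have [-> | p0] := posnP p; first by rewrite /gain mul0n div0n.
rewrite /gain -ltnS ltn_divLR //.
have : p * t.+1 <= t.+1 * q by rewrite mulnC leq_mul2l p_le_q orbT.
nia.
Qed.

(** Cell 1 holds the current gain and cell 2 the slack [d] of [gain_eq]. As [p <= q], one more item
    raises the gain by at most one: either the slack drops by [p], or the gain is incremented and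
    the slack grows by [q - p]. *)
Definition gain_cmd : cmd :=
  block [:: Op (IConst 0 0); Op (IConst 1 0); Op (IAdd 29 30 2);
    Op (IAdd 27 30 3);
    While 0 28 (block [::
      Op (IStore 1 3);
      If 22 2 (Op (ISub 2 22 2)) (Seq (Op (IAdd 1 31 1)) (Op (IAdd 2 29 2)));
      Op (IAdd 3 31 3); Op (IAdd 0 31 0)])].

Definition opt_entry_cmd : cmd :=
  block [:: Op (IConst 1 0); Op (IConst 0 0); Op (IAdd 17 7 2);
    Op (IAdd 27 30 3); Op (IAdd 7 31 4);
    While 0 4 (block [::
      Op (ILoad 2 5); Op (ILoad 3 6); Op (IAdd 5 6 5);
      If 1 5 (Op (IAdd 5 30 1)) Skip;
      Op (ISub 2 31 2); Op (IAdd 3 31 3); Op (IAdd 0 31 0)])].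

Definition opt_cmd : cmd :=
  block [:: Op (IConst 9 1); Op (IAdd 27 30 17); Op (IAdd 27 28 10);
    While 9 20 (block [::
      Op (IConst 7 0);
      While 7 28 (block [::
        opt_entry_cmd;
        Op (IAdd 10 7 8); Op (IStore 1 8); Op (IAdd 7 31 7)]);
      Op (IAdd 10 30 17); Op (IAdd 10 28 10); Op (IAdd 9 31 9)])].

Section Opt.
Variables (X p q l base : nat).
Hypotheses (l_le_X : l <= X) (q0 : 0 < q) (p_le_q : p <= q) (base_ge : 32 <= base).

Lemma wp_gain M Q :
  M 22 = p -> M 27 = base -> M 28 = l -> M 29 = q - p -> M 30 = 0 -> M 31 = 1 ->
  (forall M', (forall t, t < l -> M' (base + t) = gain p q t) ->
     (forall z, 4 <= z < base -> M' z = M z) -> Q M') ->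
  wp X gain_cmd Q M.
Proof.
move=> M22 M27 M28 M29 M30 M31 HQ; rewrite /gain_cmd /block /=; op; op; op; op.
rewrite M27 M29 M30 !addn0; apply: wp_seq.
apply: (@wp_for _ _ _ l _ (fun t M' => [/\ M' 0 = t, M' 3 = base + t,
  M' 2 + p * t.+1 = (M' 1).+1 * q /\ (M' 2 < q \/ p = 0 /\ M' 1 = 0),
  forall i, i < t -> M' (base + i) = gain p q i &
  forall z, 4 <= z < base -> M' z = M z])) => //.
- rewrite /= addn0; split=> //; first by lia.
  by move=> z hz; unupd.
- by move=> i M1 [h1 _ _ _ h5] _; rewrite (h5 28) //; lia.
- move=> t M1 [h1 h2 [h3 h3'] h4 h5] tl.
  have [e22 e29 e31] : [/\ M1 22 = p, M1 29 = q - p & M1 31 = 1].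
    by rewrite !h5 //; lia.
  have Eg := gain_eq h3 h3'.
  apply: wp_seq; apply: (@wp_store _ _ _ (base + t)) => // M2 M2x hM2.
  have E z : z < base -> M2 z = M1 z by move=> hz; apply: hM2; lia.
  have A i : i < t.+1 -> M2 (base + i) = gain p q i.
    rewrite ltnS leq_eqVlt => /predU1P [-> | it]; first by rewrite M2x.
    by rewrite hM2 ?h4 //; lia.
  apply: wp_seq; apply: wp_if; rewrite !E ?e22; try lia.
  + move=> le; apply: wp_op => //=; op; op; apply: wp_skip => /=.
    rewrite !E ?e22 ?e31 ?h1 ?h2; try lia.
    split; try lia.
    * by move=> i it; unupd; apply: A.
    * by move=> z hz; unupd; rewrite E ?h5 //; lia.
  + move=> lt; op; apply: wp_op => //=; op; op; apply: wp_skip => /=.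
    rewrite !E ?e22 ?e29 ?e31 ?h1 ?h2; try lia.
    split; try lia.
    * by move=> i it; unupd; apply: A.
    * by move=> z hz; unupd; rewrite E ?h5 //; lia.
- by move=> M1 [_ _ _ h4 h5]; apply: wp_skip; apply: HQ.
Qed.

Lemma wp_opt_entry M row i j Q :
  M 7 = j -> j < l -> M 17 = row -> 32 <= row -> M 27 = base -> M 30 = 0 ->
  M 31 = 1 ->
  (forall t, t < l -> M (base + t) = gain p q t) ->
  (forall t, t < l -> M (row + t) = opt p q i t) ->
  (forall M', M' 1 = opt p q i.+1 j -> (forall z, 7 <= z -> M' z = M z) ->
     Q M') ->
  wp X opt_entry_cmd Q M.
Proof.
move=> M7 jl M17 row_ge M27 M30 M31 Mg Mo HQ; rewrite /opt_entry_cmd /block /=.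
op; op; op; op; op; rewrite M7 M17 M27 M30 M31 addn0 addn1; apply: wp_seq.
(* After the last round the pointer in cell 2 has left the row at its front, so its value is claimed
   only for [t <= j]. *)
apply: (@wp_for _ _ _ j.+1 _ (fun t M' => [/\ M' 0 = t,
  M' 1 = \max_(s < t) (opt p q i (j - s) + gain p q s),
  t <= j -> M' 2 = row + (j - t), M' 3 = base + t /\ M' 4 = j.+1 &
  forall z, 7 <= z -> M' z = M z])) => //; first lia.
- by rewrite /= big_ord0 subn0 addn0; split=> // z hz; unupd.
- by move=> t M1 [h1 _ _ [_ h4] _] _.
- move=> t M1 [h1 h2 h3 [h4 h4'] h5] tj; rewrite ltnS in tj; have {}h3 := h3 tj.
  have e30 : M1 30 = 0 by rewrite h5.
  have e31 : M1 31 = 1 by rewrite h5.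
  have e1 : M1 (row + (j - t)) = opt p q i (j - t).
    by rewrite h5 ?Mo //; lia.
  have e2 : M1 (base + t) = gain p q t by rewrite h5 ?Mg //; lia.
  op; op; op; rewrite h3 h4 e1.
  have -> : (if base + t == 5 then opt p q i (j - t) else M1 (base + t))
    = gain p q t by rewrite ifN_eq //; lia.
  set v := opt p q i (j - t) + gain p q t.
  have E1 u M' : M' 0 = t -> M' 1 = maxn u v ->
      M' 2 = row + (j - t) -> M' 3 = base + t -> M' 4 = j.+1 ->
      (forall z, 7 <= z -> M' z = M z) ->
      u = \max_(s < t) (opt p q i (j - s) + gain p q s) ->
      wp X (block [:: Op (ISub 2 31 2); Op (IAdd 3 31 3); Op (IAdd 0 31 0)])
        (fun M' => [/\ M' 0 = t.+1,
        M' 1 = \max_(s < t.+1) (opt p q i (j - s) + gain p q s),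
        t.+1 <= j -> M' 2 = row + (j - t.+1), M' 3 = base + t.+1 /\ M' 4 = j.+1 &
        forall z, 7 <= z -> M' z = M z]) M'.
    move=> k0 k1 k2 k3 k4 k5 eu; rewrite {}eu in k1.
    rewrite /block /=; op; op; op; apply: wp_skip => /=.
    rewrite k0 k1 k2 k3 k4 (k5 31) // M31 !addn1 addnS big_ord_recr /=.
    split=> //; first lia.
    by move=> z hz; unupd; apply: k5.
  apply: wp_seq; apply: wp_if => /= le.
    apply: wp_op => //=; apply: (E1 (M1 1)) => //=.
      by rewrite e30 addn0; move: le; rewrite /v; lia.
    by move=> z hz; unupd; apply: h5.
  apply: wp_skip; apply: (E1 (M1 1)) => //=; first by move: le; rewrite /v; lia.
  by move=> z hz; unupd; apply: h5.
- by move=> M1 [_ h2 _ _ h5]; apply: wp_skip; apply: HQ.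
Qed.

Definition table_at (M : memory) (k : nat) : Prop :=
  forall i j, i <= k -> j < l -> M (base + i * l + j) = opt p q i j.

Lemma wp_opt M n Q :
  0 < n <= X -> M 20 = n -> M 27 = base -> M 28 = l -> M 30 = 0 -> M 31 = 1 ->
  (forall t, t < l -> M (base + t) = gain p q t) ->
  (forall M', M' 17 = base + n.-1 * l -> table_at M' n.-1 ->
     (forall z, 18 <= z < base -> M' z = M z) -> Q M') ->
  wp X opt_cmd Q M.
Proof.
move=> nX M20 M27 M28 M30 M31 Mg HQ; rewrite /opt_cmd /block /=; op; op; op.
rewrite M27 M28 M30 addn0; apply: wp_seq.
(* Row 0 of the table is the list of gains itself, so the counter starts at 1 and stays one ahead of
   the last finished row [k]. *)
apply: (@wp_while _ _ _ _ (fun k M' => [/\ k < n, M' 9 = k.+1,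
  M' 17 = base + k * l /\ M' 10 = base + k.+1 * l, table_at M' k &
  forall z, 18 <= z < base -> M' z = M z])).
- rewrite /= mul1n addn0; split=> //; first lia.
    move=> i j; rewrite leqn0 => /eqP -> jl; rewrite addn0 /= -Mg //; by unupd.
  by move=> z hz; unupd.
- move=> k M1 [kn h9 [h17 h10] tb h5]; rewrite h9 (h5 20) ?M20; last lia.
  move=> lt; split; first lia.
  op; apply: wp_seq.
  apply: (@wp_for _ _ _ l _ (fun j M' => [/\ M' 7 = j,
    forall s, s < j -> M' (base + k.+1 * l + s) = opt p q k.+1 s &
    forall z, 9 <= z < base + k.+1 * l -> M' z = M1 z])) => //.
  + by split=> // z hz; unupd.
  + by move=> j M2 [h1 _ h3] _; rewrite (h3 28) ?(h5 28) //; lia.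
  + move=> j M2 [h1 h2 h3] jl.
    have tb2 : table_at M2 k.
      move=> i s ik sl; rewrite h3 ?tb //.
      have : i * l + s < k.+1 * l by nia.
      lia.
    apply: wp_seq; apply: (@wp_opt_entry _ (base + k * l) k j) => //; try lia.
    * by rewrite h3 //; lia.
    * by rewrite h3 ?h5 //; lia.
    * by rewrite h3 ?h5 //; lia.
    * by rewrite h3 ?h5 //; lia.
    * by move=> t tl; have := tb2 0 t (leq0n _) tl; rewrite mul0n addn0.
    * by move=> t tl; apply: tb2.
    move=> M3 M31' hM3; op; rewrite !hM3 // (h3 10) ?h10 ?h1; last lia.
    apply: wp_seq; apply: (@wp_store _ _ _ (base + k.+1 * l + j)) => //= M4 M4x hM4.
    op; apply: wp_skip => /=.
    have E z : 9 <= z -> z != base + k.+1 * l + j -> M4 z = M2 z.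
      by move=> hz hz'; rewrite hM4 //; unupd; apply: hM3; lia.
    rewrite (E 31) ?(h3 31) ?(h5 31) ?M31; try lia.
    rewrite hM4 //= ?hM3 // ?h1 ?addn1; try lia.
    split=> //.
    * move=> s; rewrite ltnS leq_eqVlt => /predU1P [-> | sj]; unupd => //.
        by rewrite M4x M31'.
      by rewrite E ?h2 //; lia.
    * by move=> z hz; unupd; rewrite E ?h3 //; lia.
  + move=> M2 [h1 h2 h3]; op; op; op; apply: wp_skip => /=.
    rewrite !h3 ?h9 ?h10 ?(h5 28) ?(h5 30) ?(h5 31); try lia.
    rewrite M28 M30 M31; split; try lia.
    * move=> i j; rewrite leq_eqVlt => /predU1P [-> | ik] jl; unupd.
        exact: h2.
      rewrite h3 ?tb //.
      have : i * l + j < k.+1 * l by nia.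
      lia.
    * by move=> z hz; unupd; rewrite h3 ?h5 //; lia.
- move=> k M1 [kn h9 [h17 h10] tb h5]; rewrite h9 (h5 20) ?M20; last lia.
  move=> le; have E : k = n.-1 by lia.
  by rewrite E in h17 tb; apply: wp_skip; apply: HQ.
Qed.
End Opt.

(** * Distributing the ranks among the agents *)

Definition search_cmd : cmd :=
  block [:: Op (IConst 0 0); Op (IAdd 13 10 1); Op (IAdd 27 30 2);
    Op (ILoad 1 3); Op (ILoad 2 4); Op (IAdd 3 4 3);
    While 3 5 (block [::
      Op (IAdd 0 31 0); Op (ISub 1 31 1); Op (IAdd 2 31 2);
      Op (ILoad 1 3); Op (ILoad 2 4); Op (IAdd 3 4 3)])].

Definition fill_down_cmd : cmd :=
  block [:: Op (IConst 6 0);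
    While 6 7 (block [::
      Op (ISub 12 31 12); Op (IStore 9 12); Op (IAdd 6 31 6)])].

Definition fill_up_cmd : cmd :=
  block [:: Op (IConst 6 0);
    While 6 8 (block [::
      Op (IStore 9 11); Op (IAdd 11 31 11); Op (IAdd 6 31 6)])].

Definition plan_cmd : cmd :=
  block [:: Op (ISub 20 31 9); Op (ISub 28 31 10); Op (IAdd 26 30 11);
    Op (IAdd 26 21 12);
    While 30 9 (block [::
      Op (ISub 17 28 13); Op (IAdd 17 10 5); Op (ILoad 5 5);
      search_cmd;
      Op (ILoad 2 7);
      fill_down_cmd;
      Op (ISub 10 0 10); Op (IAdd 0 31 8); Op (ISub 8 7 8);
      fill_up_cmd;
      Op (IAdd 13 30 17); Op (ISub 9 31 9)])].

Lemma wp_fill_down X M g i bot Q :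
  g <= X -> M 7 = g -> M 9 = i -> M 12 = bot -> M 31 = 1 -> 32 + g <= bot ->
  (forall M', M' 12 = bot - g ->
     (forall z, z != 6 -> z != 12 ->
        M' z = if bot - g <= z < bot then i else M z) -> Q M') ->
  wp X fill_down_cmd Q M.
Proof.
move=> gX M7 M9 M12 M31 bg HQ; rewrite /fill_down_cmd /block /=; op.
apply: wp_seq; apply: (@wp_for _ _ _ g _ (fun k M' => [/\ M' 6 = k,
  M' 12 = bot - k & forall z, z != 6 -> z != 12 ->
        M' z = if bot - k <= z < bot then i else M z])) => //.
- rewrite /= M12 subn0; split=> // z z6 z12; unupd.
  by rewrite ifF //; lia.
- by move=> k M1 [h1 h2 h3] kg; rewrite (h3 7) // ifF ?M7 //; lia.
- move=> k M1 [h1 h2 h3] kg.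
  have e9 : M1 9 = i by rewrite h3 // ifF ?M9 //; lia.
  have e31 : M1 31 = 1 by rewrite h3 // ifF ?M31 //; lia.
  op; rewrite h2 e31.
  apply: wp_seq; apply: (@wp_store _ _ _ (bot - k - 1)) => //= M2 M2x hM2.
  op; apply: wp_skip => /=.
  rewrite !hM2 /= ?h1 ?e31 //; try lia.
  split; try lia.
  move=> z z6 z12; rewrite /upd (negbTE z6).
  case: (z =P bot - k - 1) => [-> | zx].
    by rewrite M2x ifT //; lia.
  rewrite hM2 /=; last by apply/eqP.
  rewrite (negbTE z12) h3 //; congr (if _ then _ else _); lia.
- by move=> M1 [h1 h2 h3]; apply: wp_skip; apply: HQ.
Qed.

Lemma wp_fill_up X M g i top Q :
  g <= X -> M 8 = g -> M 9 = i -> M 11 = top -> M 31 = 1 -> 32 <= top ->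
  (forall M', M' 11 = top + g ->
     (forall z, z != 6 -> z != 11 ->
        M' z = if top <= z < top + g then i else M z) -> Q M') ->
  wp X fill_up_cmd Q M.
Proof.
move=> gX M8 M9 M11 M31 tg HQ; rewrite /fill_up_cmd /block /=; op.
apply: wp_seq; apply: (@wp_for _ _ _ g _ (fun k M' => [/\ M' 6 = k,
  M' 11 = top + k & forall z, z != 6 -> z != 11 ->
        M' z = if top <= z < top + k then i else M z])) => //.
- rewrite /= M11 addn0; split=> // z z6 z12; unupd.
  by rewrite ifF //; lia.
- by move=> k M1 [h1 h2 h3] kg; rewrite (h3 8) // ifF ?M8 //; lia.
- move=> k M1 [h1 h2 h3] kg.
  have e9 : M1 9 = i by rewrite h3 // ifF ?M9 //; lia.
  have e31 : M1 31 = 1 by rewrite h3 // ifF ?M31 //; lia.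
  apply: wp_seq; apply: (@wp_store _ _ _ (top + k)) => //= M2 M2x hM2.
  op; op; apply: wp_skip => /=.
  rewrite !hM2 /= ?h1 ?h2 ?e31 //; try lia.
  split; try lia.
  move=> z z6 z11; rewrite /upd (negbTE z6) (negbTE z11).
  case: (z =P top + k) => [-> | zx].
    by rewrite M2x ifT //; lia.
  rewrite hM2 /=; last by apply/eqP.
  rewrite h3 //; congr (if _ then _ else _); lia.
- by move=> M1 [h1 h2 h3]; apply: wp_skip; apply: HQ.
Qed.

Section Plan.
Variables (X p q l base : nat).
Hypotheses (l_le_X : l <= X) (q0 : 0 < q) (p_le_q : p <= q) (base_ge : 32 <= base).

(** Backtracking through the table: some [t0] attains the maximum that defines the entry, so the
    scan stops at [t0] at the latest, before its pointer leaves the row. Where it stops the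
    candidate is at least the maximum, hence equal to it. *)
Lemma wp_search M row i j Q :
  j < l -> M 5 = opt p q i.+1 j -> M 10 = j -> M 13 = row -> 32 <= row ->
  M 27 = base -> M 30 = 0 -> M 31 = 1 ->
  (forall t, t < l -> M (base + t) = gain p q t) ->
  (forall t, t < l -> M (row + t) = opt p q i t) ->
  (forall M' t, t <= j -> opt p q i (j - t) + gain p q t = opt p q i.+1 j ->
     M' 0 = t -> M' 2 = base + t ->
     (forall z, 5 <= z -> M' z = M z) -> Q M') ->
  wp X search_cmd Q M.
Proof.
move=> jl M5 M10 M13 row_ge M27 M30 M31 Mg Mo HQ; rewrite /search_cmd /block /=.
have [t0 t0j Et0] : exists2 t, t <= j &
    opt p q i.+1 j = opt p q i (j - t) + gain p q t.
  have [|t] := eq_bigmax (fun t : 'I_j.+1 => opt p q i (j - t) + gain p q t).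
    by rewrite card_ord.
  by move=> Et; exists (val t); [rewrite -ltnS; apply: ltn_ord | apply: Et].
have ub t : t <= j -> opt p q i (j - t) + gain p q t <= opt p q i.+1 j.
  rewrite -ltnS => tj.
  exact: (leq_bigmax (F := fun t : 'I__ => opt p q i (j - t) + gain p q t)
    (Ordinal tj)).
op; op; op; op; op; op; rewrite M10 M13 M27 M30 !addn0.
rewrite !ifN_eq; try lia.
have [g0 ->] : M base = gain p q 0 /\ M (row + j) = opt p q i j.
  by rewrite -[base]addn0 Mg ?Mo //; lia.
rewrite g0.
apply: wp_seq; apply: (@wp_while _ _ _ _ (fun t M' => [/\ t <= t0, M' 0 = t,
  M' 1 = row + (j - t) /\ M' 2 = base + t,
  M' 3 = opt p q i (j - t) + gain p q t &
  forall z, 5 <= z -> M' z = M z])).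
- by rewrite /= addn0 subn0; split=> // z hz; unupd.
- move=> t M1 [tt h0 [h1 h2] h3 h5]; rewrite h3 h5 // M5 => lt.
  have {}tt : t < t0.
    by rewrite ltn_neqAle tt andbT; apply: contraTneq lt => ->; rewrite Et0 ltnn.
  split; first lia.
  op; op; op; op; op; op; apply: wp_skip => /=.
  rewrite !ifN_eq; try (rewrite ?h1 ?h2 ?h5 // ?M31; lia).
  rewrite h0 h1 h2 !h5 // ?M31; try lia.
  have -> : row + (j - t) - 1 = row + (j - t.+1) by lia.
  rewrite Mo; last lia.
  rewrite addn1 -addnA addn1 Mg; last lia.
  split=> //.
  by move=> z hz; unupd; apply: h5.
- move=> t M1 [tt h0 [h1 h2] h3 h5]; rewrite h3 h5 // M5 => le.
  apply: wp_skip; apply: (HQ _ t) => //; first by lia.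
  by apply/eqP; rewrite eqn_leq ub //; lia.
Qed.

(* [Ts] and [Bs] list the owners of the items already given to the agents
   above [i]: [Ts] those of the best items, [Bs] those of the worst. *)
Definition partial_plan n m i j (Ts Bs : seq nat) : Prop :=
  [/\ size Ts + (i.+1 + j) + size Bs = m,
      size Bs + opt p q i j = opt p q n.-1 l.-1,
      all (fun a => i < a < n) (Ts ++ Bs) &
      forall a, i < a < n -> exists2 t, count_mem a Bs = gain p q t &
        count_mem a Ts + gain p q t = t.+1].

Lemma partial_plan_step n m i j t Ts Bs :
  i.+1 < n -> t <= j -> opt p q i (j - t) + gain p q t = opt p q i.+1 j ->
  partial_plan n m i.+1 j Ts Bs ->
  partial_plan n m i (j - t) (Ts ++ nseq (t.+1 - gain p q t) i.+1)
    (nseq (gain p q t) i.+1 ++ Bs).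
Proof.
move=> lin tj E [h1 h2 h3 h4]; have gt := gain_le t q0 p_le_q.
have sub s : all (fun a => i.+1 < a < n) s ->
    all (fun a => i < a < n) s /\ count_mem i.+1 s = 0.
  move=> hs; split; first by apply: sub_all hs => a; lia.
  apply/eqP; rewrite -leqn0 leqNgt -has_count -all_predC.
  by apply: sub_all hs => a /=; lia.
move: h3; rewrite all_cat => /andP [/sub [aT cT] /sub [aB cB]].
split.
- by rewrite !size_cat !size_nseq; lia.
- by rewrite size_cat size_nseq; lia.
- rewrite !all_cat aT aB !all_nseq /= !andbT !(leqnn, lin) /=.
  by rewrite !orbT.
- move=> a /andP [ia an]; case: (eqVneq a i.+1) => [-> | na].
    by exists t; rewrite !count_cat !count_nseq /= eqxx ?cT ?cB; lia.
  have [|s] := h4 a; first lia.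
  by exists s; rewrite !count_cat !count_nseq /= eq_sym (negbTE na) ?addn0.
Qed.

(* [G ++ Bd] lists the owners of the items from best to worst; [Bd] is the
   part of the bad items, as long as possible. *)
Definition good_plan n m (G Bd : seq nat) : Prop :=
  [/\ size G + size Bd = m, size Bd = opt p q n.-1 l.-1,
      all (fun a => a < n) (G ++ Bd) &
      forall a, a < n -> exists2 t, count_mem a Bd = gain p q t &
        count_mem a G + gain p q t = t.+1].

Lemma partial_plan_end n m j Ts Bs :
  0 < n -> partial_plan n m 0 j Ts Bs ->
  good_plan n m (Ts ++ nseq (j.+1 - gain p q j) 0) (nseq (gain p q j) 0 ++ Bs).
Proof.
move=> n0 [h1 h2 h3 h4]; have gj := gain_le j q0 p_le_q.
have sub s : all (fun a => 0 < a < n) s ->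
    all (fun a => a < n) s /\ count_mem 0 s = 0.
  move=> hs; split; first by apply: sub_all hs => a /andP [].
  apply/eqP; rewrite -leqn0 leqNgt -has_count -all_predC.
  by apply: sub_all hs => a /=; lia.
move: h3; rewrite all_cat => /andP [/sub [aT cT] /sub [aB cB]].
split.
- by rewrite !size_cat !size_nseq; lia.
- by rewrite size_cat size_nseq; move: h2 => /=; lia.
- by rewrite !all_cat aT aB !all_nseq /= !n0 !orbT.
- move=> [_ | a an].
    by exists j; rewrite !count_cat !count_nseq /= ?cT ?cB; lia.
  have [|s] := h4 a.+1; first by [].
  by exists s; rewrite !count_cat !count_nseq /= ?addn0.
Qed.

(** The owner list is filled from both ends, from the last agent down to agent 1. Agent 0 needs no
    writing: the untouched middle block already holds 0. *)
Lemma wp_plan M n m own Q :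
  0 < n -> 0 < l -> n + l = m.+1 -> m <= X -> M 20 = n -> M 21 = m -> M 26 = own -> M 27 = base ->
  M 28 = l -> M 30 = 0 -> M 31 = 1 -> M 17 = base + n.-1 * l ->
  table_at p q l base M n.-1 -> 32 <= own -> own + m <= base ->
  (forall r, r < m -> M (own + r) = 0) ->
  (forall M' G Bd, good_plan n m G Bd ->
     (forall r, r < m -> M' (own + r) = nth 0 (G ++ Bd) r) ->
     (forall z, 18 <= z -> (z < own) || (own + m <= z) -> M' z = M z) ->
     Q M') ->
  wp X plan_cmd Q M.
Proof.
move=> n0 l0 nl mX M20 M21 M26 M27 M28 M30 M31 M17 tb own_ge own_le Mz HQ.
rewrite /plan_cmd /block /=; op; op; op; op.
rewrite M20 M21 M26 M28 M30 M31 !subn1 addn0; apply: wp_seq.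
apply: (@wp_while _ _ _ _ (fun k M' => exists j Ts Bs,
  [/\ k <= n.-1 /\ M' 9 = n.-1 - k, j < l /\ M' 10 = j,
      M' 17 = base + (n.-1 - k) * l /\
        M' 11 = own + size Ts /\ M' 12 = own + m - size Bs,
      partial_plan n m (n.-1 - k) j Ts Bs &
      (forall r, r < m -> M' (own + r) =
         nth 0 (Ts ++ nseq ((n.-1 - k).+1 + j) 0 ++ Bs) r) /\
      (forall z, 18 <= z -> (z < own) || (own + m <= z) -> M' z = M z)])).
- exists l.-1, [::], [::]; rewrite /= subn0 cats0; split; try lia.
  + by split=> //= [|a]; lia.
  + split=> [r rm | z hz hz2]; last by unupd.
    rewrite -[0 :: _]/(nseq (n.-1.+1 + l.-1) 0) nth_nseq if_same; unupd.
    exact: Mz.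
- move=> k M1 [j [Ts [Bs [[kn h9] [jl h10] [h17 [h11 h12]] pp [hown hk]]]]].
  rewrite (hk 30) ?M30 ?h9; try lia.
  move=> ik; split; first lia.
  have [i Ei] : exists i, n.-1 - k = i.+1 by exists (n.-1 - k).-1; lia.
  have Ei' : n.-1 - k.+1 = i by lia.
  rewrite Ei' => {ik}; rewrite Ei in h9 h17 pp hown.
  have [e27 e28 e30 e31] : [/\ M1 27 = base, M1 28 = l, M1 30 = 0 & M1 31 = 1].
    by rewrite !hk //; lia.
  have tb1 a s : a <= n.-1 -> s < l -> M1 (base + a * l + s) = opt p q a s.
    by move=> an sl; rewrite hk ?tb //; lia.
  op; op; op; rewrite h10 h17 e28.
  have -> : base + i.+1 * l - l = base + i * l by rewrite mulSn; lia.
  rewrite !ifN_eq; try lia.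
  rewrite tb1; try lia.
  apply: wp_seq; apply: (@wp_search _ (base + i * l) i j) => //=; try lia.
    move=> t tl; unupd; have := tb1 0 t (leq0n _) tl.
    by rewrite mul0n addn0.
    by move=> t tl; unupd; apply: tb1; lia.
  move=> M2 t tj Eopt k0 k2 hM2; have gt := gain_le t q0 p_le_q.
  have E2 z : 6 <= z -> z != 13 -> M2 z = M1 z.
    by move=> hz z13; rewrite hM2 /= ?(negbTE z13); [unupd | lia].
  have [s1 s2 s3 s4] := pp.
  have eg : M2 (base + t) = gain p q t.
    rewrite E2; try lia.
    by have := tb1 0 t; rewrite mul0n addn0 => -> //; lia.
  op; rewrite k2 eg.
  have hbot : M1 12 = own + (size Ts + (i.+2 + j)) by rewrite h12; lia.
  apply: wp_seq; apply: (@wp_fill_down _ _ (gain p q t) i.+1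
    (own + (size Ts + (i.+2 + j)))) => //=; rewrite ?E2 //; try lia.
  move=> M3 M312 hM3.
  have E3 z : z != 6 -> z != 12 -> z < own -> M3 z = if z == 7 then gain p q t else M2 z.
    by move=> z6 z12 zo; rewrite hM3 // ifF //; lia.
  op; op; op; apply: wp_seq.
  rewrite (E3 0) ?(E3 7) ?(E3 10) ?(E3 31) //=; try lia.
  rewrite k0 !E2 // h10 e31 addn1.
  apply: (@wp_fill_up _ _ (t.+1 - gain p q t) i.+1 (own + size Ts)) => //=;
    rewrite ?E3 /= ?E2 //; try lia.
  move=> M4 M411 hM4; op; op; apply: wp_skip => /=.
  have E4 z : z != 6 -> z != 11 -> z != 8 -> z != 10 -> z < own ->
      M4 z = M3 z.
    move=> *; rewrite hM4 // ifF; last lia.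
    by unupd.
  exists (j - t), (Ts ++ nseq (t.+1 - gain p q t) i.+1),
    (nseq (gain p q t) i.+1 ++ Bs).
  have pp' := partial_plan_step (n := n) (m := m) (i := i) _ tj Eopt pp.
  rewrite !size_cat !size_nseq.
  have own4 r : r < m -> M4 (own + r) = nth 0 ((Ts ++ nseq (t.+1 - gain p q t) i.+1)
      ++ nseq (i.+1 + (j - t)) 0 ++ nseq (gain p q t) i.+1 ++ Bs) r.
    move=> rm; rewrite hM4; try lia.
    rewrite !ifN_eq; try lia.
    rewrite hM3; try lia.
    rewrite !ifN_eq; try lia.
    rewrite E2 ?hown //; try lia.
    rewrite !nth_cat !size_cat !size_nseq !nth_nseq.
    repeat (case: ifP => ?); try lia.
    by congr (nth 0 Bs _); lia.
  have e13 : M2 13 = base + i * l by rewrite hM2.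
  rewrite !(E4 9) ?(E4 13) ?(E4 30) ?(E4 31) ?(E4 12) //; try lia.
  rewrite (E3 9) ?(E3 13) ?(E3 30) ?(E3 31) //= ?e13; try lia.
  rewrite !E2 // h9 e31 e30 addn0 M411 M312.
  split; try lia.
  + by split; [lia | rewrite hM4 // ifF //; lia].
  + by apply: pp'; lia.
  + split=> [r rm | z hz hz2]; unupd; first exact: own4.
    rewrite hM4 ?ifF ?ifN_eq ?hM3 ?ifF ?ifN_eq ?E2 ?hk //; lia.
- move=> k M1 [j [Ts [Bs [[kn h9] [jl h10] [h17 [h11 h12]] pp [hown hk]]]]].
  rewrite (hk 30) ?M30 ?h9; try lia.
  move=> le; have E : n.-1 - k = 0 by lia.
  rewrite E in pp hown; apply: wp_skip.
  apply: HQ (partial_plan_end n0 pp) _ hk => r rm.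
  (* The block of agent 0 is cut so that its last [gain p q j] cells count as bad. *)
  rewrite hown // -catA; congr nth; congr (_ ++ _); rewrite catA; congr (_ ++ _).
  by rewrite add1n -(subnK (leq_trans (gain_le j q0 p_le_q) (leqnSn j))) nseqD addnK.
Qed.

End Plan.

(** * The whole program *)

(** Unrolled, because a loop would need cells for its counter and bound while these cells still hold
    input. *)
Fixpoint save_cells (x k : nat) : cmd :=
  if k is k'.+1 then
    Seq (Op (IStore x 0)) (Seq (Op (IAdd 0 5 0)) (save_cells x.+1 k'))
  else Skip.

Fixpoint load_cells (x k : nat) : cmd :=
  if k is k'.+1 then
    Seq (Op (ILoad 0 x)) (Seq (Op (IAdd 0 31 0)) (load_cells x.+1 k'))
  else Skip.

(* Moves the input from cell 5 on to the address [32 + 16 * m], which frees the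
   cells below 32; cell 0, whose initial content [4 + 2 * m] is redundant,
   serves as the pointer. *)
Definition relocate_cmd : cmd :=
  block [:: Op (IAdd 0 0 0); Op (IAdd 0 0 0); Op (IAdd 0 0 0);
    Op (IStore 5 0); Op (IConst 5 1); Op (IAdd 0 5 0);
    save_cells 6 26;
    Op (IConst 6 32); Op (IConst 8 5); Op (IAdd 2 2 7); Op (IAdd 7 8 7);
    While 6 7 (block [::
      Op (ILoad 6 8); Op (IStore 8 0); Op (IAdd 0 5 0); Op (IAdd 6 5 6)])].

Definition setup_cmd : cmd :=
  block [:: Op (IConst 30 0); Op (IConst 31 1);
    Op (IAdd 1 30 20); Op (IAdd 2 30 21); Op (IAdd 3 30 22); Op (IAdd 4 30 23);
    Op (IAdd 2 2 0); Op (IAdd 0 0 0); Op (IAdd 0 0 0); Op (IAdd 0 0 0);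
    Op (IConst 1 32); Op (IAdd 0 1 24);
    Op (IAdd 24 2 25); Op (IAdd 25 2 25); Op (IAdd 25 2 26); Op (IAdd 26 2 27);
    Op (ISub 23 22 29); Op (ISub 21 20 28); Op (IAdd 28 31 28)].

(* Moves the result to the cells from 1 on.  At the end only cell 0 is left as
   a pointer to the last cell that was read, so [m] is stored beforehand at
   twice that address. *)
Definition finish_cmd : cmd :=
  block [:: Op (IConst 0 30); Op (IAdd 25 0 0); Op (IAdd 0 0 0);
    Op (IStore 21 0);
    Op (IAdd 21 31 3); Op (IConst 1 32); Op (IConst 2 31); Op (IAdd 25 2 2);
    While 1 3 (block [::
      Op (ILoad 2 4); Op (IStore 4 1); Op (IAdd 1 31 1); Op (IAdd 2 31 2)]);
    Op (IAdd 25 30 0);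
    load_cells 1 30;
    Op (ILoad 0 31); Op (IAdd 0 0 0); Op (ILoad 0 0)].

Definition program_cmd : cmd :=
  block [:: relocate_cmd; setup_cmd;
    If 20 21 (block [:: gain_cmd; opt_cmd; plan_cmd; output_cmd]) Skip;
    finish_cmd].

Lemma wp_save_cells X x k M B Q :
  M 0 = B -> M 5 = 1 -> 32 <= B -> 5 < x -> x + k <= 32 ->
  (forall M', M' 0 = B + k -> (forall r, r < k -> M' (B + r) = M (x + r)) ->
    (forall z, 0 < z -> (z < B) || (B + k <= z) -> M' z = M z) -> Q M') ->
  wp X (save_cells x k) Q M.
Proof.
elim: k x B M => [|k IH] x B M M0 M5 B32 x5 xk HQ /=.
  by apply: wp_skip; apply: HQ => //; rewrite addn0.
apply: wp_seq; apply: (@wp_store _ _ _ B) => // M1 M1x hM1.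
op; rewrite !hM1 ?M0 ?M5 ?addn1; try lia.
apply: (IH _ B.+1) => //=; try lia.
  by rewrite hM1 //; lia.
move=> M2 h0 h1 h2; apply: HQ; first by rewrite h0; lia.
- move=> [_ | r rk]; first by rewrite addn0 h2 /= ?ifN_eq ?M1x ?addn0 //; lia.
  by rewrite -addSnnS h1 ?addSnnS //= ?ifN_eq ?hM1 //; lia.
- by move=> z z0 hz; rewrite h2 /= ?ifN_eq ?hM1 //; lia.
Qed.

Lemma wp_load_cells X d k M x Q :
  M 0 = x -> M 31 = 1 -> 32 <= x -> 0 < d -> d + k <= 31 ->
  (forall M', M' 0 = x + k -> (forall r, r < k -> M' (d + r) = M (x + r)) ->
    (forall z, 0 < z -> (z < d) || (d + k <= z) -> M' z = M z) -> Q M') ->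
  wp X (load_cells d k) Q M.
Proof.
elim: k d x M => [|k IH] d x M M0 M31 x32 d0 dk HQ /=.
  by apply: wp_skip; apply: HQ => //; rewrite addn0.
op; op; rewrite M0 !ifN_eq ?M31 ?addn1; try lia.
apply: (IH _ x.+1) => //=; try lia.
  by rewrite ifN_eq //; lia.
move=> M2 h0 h1 h2; apply: HQ; first by rewrite h0; lia.
- move=> [_ | r rk].
    by rewrite !addn0 h2; [rewrite eqxx ifN_eq //; lia | lia | lia].
  by rewrite -addSnnS h1 ?addSnnS //= !ifN_eq //; lia.
- by move=> z z0 hz; rewrite h2 /= ?ifN_eq //; lia.
Qed.

Arguments save_cells : simpl never.
Arguments load_cells : simpl never.

Section Program.
Variables (X n m p q : nat) (a b : seq nat).
Hypotheses (n0 : 0 < n) (q0 : 0 < q) (p_le_q : p <= q).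
Let inp := encode_instance n m p q a b.

Lemma init_memE : [/\ init_mem inp 1 = n, init_mem inp 2 = m,
  init_mem inp 3 = p & init_mem inp 4 = q].
Proof. by []. Qed.

Lemma size_flatten_pairs (s : seq nat) (f g : nat -> nat) :
  size (flatten [seq [:: f j; g j] | j <- s]) = (size s).*2.
Proof. by elim: s => //= x s ->. Qed.

Lemma nth_flatten_pairs k x (f g : nat -> nat) j :
  let s := flatten [seq [:: f i; g i] | i <- iota x k] in j < k ->
  nth 0 s j.*2 = f (x + j) /\ nth 0 s j.*2.+1 = g (x + j).
Proof.
elim: k x j => //= k IH x [|j] jk /=; first by rewrite addn0.
by rewrite -addSnnS; apply: IH.
Qed.

Lemma size_inp : size inp = 4 + m.*2.
Proof. by rewrite /inp /encode_instance /= size_flatten_pairs size_iota. Qed.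

Lemma init_mem0 : init_mem inp 0 = 4 + m.*2.
Proof. exact: size_inp. Qed.

Lemma init_mem_item j : j < m ->
  init_mem inp (5 + j.*2) = nth 0 a j /\ init_mem inp (5 + j.*2).+1 = nth 0 b j.
Proof. exact: (@nth_flatten_pairs m 0 (nth 0 a) (nth 0 b) j). Qed.

Lemma init_mem_out z : 4 + m.*2 < z -> init_mem inp z = 0.
Proof. by case: z => // z hz; rewrite /= nth_default // size_inp; lia. Qed.

Lemma wp_relocate Q : m.*2 <= X ->
  (forall M', (forall z, 0 < z < 5 -> M' z = init_mem inp z) ->
     (forall r, M' (32 + 16 * m + r) = init_mem inp (5 + r)) -> Q M') ->
  wp X relocate_cmd Q (init_mem inp).
Proof.
have [i1 i2 i3 i4] := init_memE.
have i0 := init_mem0.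
have iout := init_mem_out.
move: (init_mem inp) i0 i1 i2 i3 i4 iout => I i0 i1 i2 i3 i4 iout mX HQ.
move eB: (32 + 16 * m) HQ => B HQ; rewrite /relocate_cmd /block [foldr _ _ _]/=.
op; op; op; rewrite i0.
have -> : 4 + m.*2 + (4 + m.*2) + (4 + m.*2 + (4 + m.*2)) +
    (4 + m.*2 + (4 + m.*2) + (4 + m.*2 + (4 + m.*2))) = B by lia.
apply: wp_seq; apply: (@wp_store _ _ _ B) => //= M1 M1x hM1.
have M10 : M1 0 = B by rewrite hM1 //; lia.
have {}hM1 z : 0 < z -> z != B -> M1 z = I z.
  by move=> z0 zB; rewrite hM1 //; unupd.
have B32 : 32 <= B by lia.
op; op; rewrite M10 addn1.
apply: wp_seq; apply: (@wp_save_cells _ _ _ _ B.+1) => //=; first lia.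
move=> M2 k0 k1 k2.
have {}k1 r : r < 27 -> M2 (B + r) = I (5 + r).
  case: r => [_ | r r27]; first by rewrite addn0 k2 ?ifN_eq ?M1x //; lia.
  by rewrite -addSnnS k1 ?hM1 ?ifN_eq //; lia.
have k5 : M2 5 = 1 by rewrite k2 //; lia.
have {}k2 z : 0 < z -> z != 5 -> (z < B) || (B + 27 <= z) -> M2 z = I z.
  by move=> z0 z5 hz; rewrite k2 ?ifN_eq ?hM1 //; lia.
have {}k0 : M2 0 = B + 27 by rewrite k0; lia.
op; op; op; op; rewrite !k2 ?i2 //; try lia.
rewrite addnn.
apply: wp_seq; apply: (@wp_while _ _ _ _ (fun k M' => [/\ M' 0 = B + 27 + k,
  M' 6 = 32 + k /\ M' 7 = m.*2 + 5, M' 5 = 1,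
  forall r, r < 27 + k -> M' (B + r) = I (5 + r) &
  forall z, 0 < z -> (z < 5) || (8 < z < B) || (B + 27 + k <= z) -> M' z = I z])).
- rewrite /= k0 k5 !addn0; split=> //.
  + by move=> r r27; rewrite !ifN_eq ?k1 //; lia.
  + by move=> z z0 hz; unupd; apply: k2; lia.
- move=> k M3 [h0 [h6 h7] h5 hr hz]; rewrite h6 h7 => lt; split; first lia.
  op; rewrite h6.
  apply: wp_seq; apply: (@wp_store _ _ _ (B + 27 + k)) => //= M4 M4x hM4.
  op; op; apply: wp_skip => /=.
  rewrite !hM4 /= ?h0 ?h5 ?h6 ?h7; try lia.
  split; try lia.
  + move=> r rk; rewrite !ifN_eq; try lia.
    have [e | ne] := eqVneq (B + r) (B + 27 + k).
      have {e}-> : r = 27 + k by lia.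
      by rewrite addnA M4x hz; try lia; congr I; lia.
    by rewrite hM4 //= !ifN_eq ?hr //; lia.
  + by move=> z z0 h; unupd; rewrite hM4 /=; [unupd; apply: hz; lia | lia].
- move=> k M3 [h0 [h6 h7] h5 hr hz]; rewrite h6 h7 => le.
  apply: wp_skip; apply: HQ => [z hz4 | r]; first by rewrite hz //; lia.
  have [rk | rk] := ltnP r (27 + k); first exact: hr.
  by rewrite hz ?iout //; lia.
Qed.

Definition env (M : memory) : Prop :=
  [seq M z | z <- iota 20 12] =
  [:: n; m; p; q; 32 + 16 * m; 32 + 18 * m; 32 + 19 * m; 32 + 20 * m;
      (m - n).+1; q - p; 0; 1].

Lemma env_keep M M' :
  env M -> (forall z, 20 <= z < 32 -> M' z = M z) -> env M'.
Proof.
rewrite /env => <- H; apply/eq_in_map => z.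
by rewrite mem_iota => hz; apply: H; lia.
Qed.

Lemma wp_setup M Q :
  (forall z, 0 < z < 5 -> M z = init_mem inp z) ->
  (forall M', env M' -> (forall z, 32 <= z -> M' z = M z) -> Q M') ->
  wp X setup_cmd Q M.
Proof.
have [i1 i2 i3 i4] := init_memE.
move=> hM HQ; have [e1 e2 e3 e4] : [/\ M 1 = n, M 2 = m, M 3 = p & M 4 = q].
  by rewrite !hM.
rewrite /setup_cmd /block [foldr _ _ _]/=.
op; op; op; rewrite e1; op; rewrite e2; op; rewrite e3; op; rewrite e4.
op; rewrite e2; op; op; op; op; op; op; rewrite e2; op; rewrite e2; op; rewrite e2.
op; rewrite e2; op; op; op; apply: wp_skip; apply: HQ.
  by rewrite /env /=; repeat (congr (_ :: _); first lia).
by move=> z hz; unupd.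
Qed.

Lemma wp_finish M x Q :
  m <= X -> M 21 = m -> M 25 = x -> M 30 = 0 -> M 31 = 1 -> 32 + m <= x ->
  (forall M', M' 0 = m -> (forall j, j < m -> M' j.+1 = M (x + j)) -> Q M') ->
  wp X finish_cmd Q M.
Proof.
move=> mX M21 M25 M30 M31 xm HQ; rewrite /finish_cmd /block [foldr _ _ _]/=.
op; op; op; rewrite M25.
apply: wp_seq; apply: (@wp_store _ _ _ (x + 30 + (x + 30))) => //= M1 M1x hM1.
have {}hM1 z : 0 < z -> z != x + 30 + (x + 30) -> M1 z = M z.
  by move=> z0 zx; rewrite hM1 //; unupd.
op; op; op; op; rewrite !hM1 ?M21 ?M25 ?M31; try lia.
apply: wp_seq; apply: (@wp_while _ _ _ _ (fun k M' => [/\ M' 1 = 32 + k,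
  M' 2 = x + 31 + k, M' 3 = m + 1,
  forall r, r < k -> M' (32 + r) = M (x + 31 + r) &
  (forall z, 4 < z < 32 -> M' z = M z) /\
  forall z, x <= z -> M' z = M1 z])).
- by rewrite /= !addn0; split=> //; split=> z hz; unupd => //; rewrite hM1 //; lia.
- move=> k M2 [h1 h2 h3 h4 [h5 h6]]; rewrite h1 h3 => lt; split; first lia.
  op; rewrite h2 h6; last lia.
  apply: wp_seq; apply: (@wp_store _ _ _ (32 + k)) => //= M3 M3x hM3.
  op; op; apply: wp_skip => /=; rewrite !hM3 /= ?h1 ?h2 ?h3 ?h5 ?M31; try lia.
  split; try lia.
  + move=> r rk; unupd; have [e | ne] := eqVneq (32 + r) (32 + k).
      have {e}-> : r = k by lia.
      rewrite M3x hM1 //; lia.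
    by rewrite hM3 //; unupd; rewrite h4 //; lia.
  + split=> z hz; unupd; rewrite hM3 /=; try lia; unupd; [apply: h5 | apply: h6].
      by [].
    by [].
- move=> k M2 [h1 h2 h3 h4 [h5 h6]]; rewrite h1 h3 => le.
  op; rewrite !h5 // M25 M30 addn0.
  apply: wp_seq; apply: (@wp_load_cells _ _ _ _ x) => //=; first by rewrite h5.
    lia.
  move=> M3 k0 k1 k2; op; op; op; apply: wp_skip; apply: HQ => /=.
    rewrite k0 !ifN_eq ?k2 /= ?ifN_eq ?h6 ?M1x //; lia.
  move=> j jm; rewrite k0.
  (* Entries below 30 come from the unrolled loads, entry 30 replaces the constant 1 in cell 31 once
     it is dispensable, and the later ones were copied by the loop. *)
  have [j30 | j30] := ltnP j 30.
    rewrite ifN_eq -?(add1n j) ?k1 /= ?ifN_eq ?h6 ?hM1 //; lia.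
  have [-> | ne] := eqVneq j 30.
    by rewrite k2 ?ifN_eq ?h6 ?hM1 //; lia.
  rewrite ifN_eq ?k2 /=; try lia.
  have -> : j.+1 = 32 + (j - 31) by lia.
  by rewrite h4; try lia; congr M; lia.
Qed.

Lemma rank_lt j : j < m -> rank a b m j < m.
Proof.
move=> jm; rewrite /rank -[X in _ < X](size_iota 0) -(count_predC (fun i => before a b i j)).
rewrite -[X in X < _]addn0 ltn_add2l -has_count; apply/hasP; exists j.
  by rewrite mem_iota.
by rewrite /= /before leqnn addn1 ltnn.
Qed.

Definition is_result (out : seq nat) : Prop :=
  if n <= m then
    exists G Bd, good_plan p q (m - n).+1 n m G Bd /\
      out = [seq nth 0 (G ++ Bd) (rank a b m j) | j <- iota 0 m]
  else out = nseq m 0.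

Lemma wp_program : m.*2 < X ->
  (forall j, j < m -> bitlen (nth 0 a j) <= X) ->
  (forall j, j < m -> bitlen (nth 0 b j) <= X) ->
  wp X program_cmd (fun M => is_result (read_output M)) (init_mem inp).
Proof.
move=> mX aX bX; rewrite /program_cmd /block [foldr _ _ _]/=.
apply: wp_seq; apply: wp_relocate; first lia.
move=> M1 h1 h2; apply: wp_seq; apply: wp_setup => // M2 env2 k2.
(* These zeros serve both as the answer when [m < n] and as the initial owner list. *)
have z2 z : 32 + 18 * m <= z -> M2 z = 0.
  move=> hz; rewrite k2; last lia.
  have -> : z = 32 + 16 * m + (z - (32 + 16 * m)) by lia.
  by rewrite h2 init_mem_out //; lia.
have read M out : M 0 = m -> size out = m ->
    (forall j, j < m -> M j.+1 = nth 0 out j) -> read_output M = out.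
  move=> M0 so H; rewrite /read_output M0; apply: (@eq_from_nth _ 0).
    by rewrite size_map size_iota.
  move=> j; rewrite size_map size_iota => jm.
  by rewrite (nth_map 0) ?size_iota // nth_iota // add0n H.
have [e20 e21 e22 e23 e24 e25 e26 e27 e28 e29 e30 e31] := env2.
apply: wp_seq; apply: wp_if; rewrite e20 e21 => nm; last first.
  apply: wp_skip; apply: wp_seq.
  apply: (@wp_finish _ (32 + 18 * m)) => //; try lia.
  move=> M3 M30 hM3; apply: wp_skip; rewrite /is_result leqNgt nm /=.
  apply: read => //; first by rewrite size_nseq.
  by move=> j jm; rewrite hM3 // z2 ?nth_nseq ?jm //; lia.
rewrite /block /=; apply: wp_seq.
apply: (@wp_gain _ p q (m - n).+1 (32 + 20 * m)) => //; try lia.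
move=> M3 g3 k3.
have env3 : env M3 by apply: (env_keep env2) => z hz; apply: k3; lia.
have {e20 e21 e22 e23 e24 e25 e26 e27 e28 e29 e30 e31}
  [e20 e21 e22 e23 e24 e25 e26 e27 e28 e29 e30 e31] := env3.
apply: wp_seq; apply: (@wp_opt _ p q (m - n).+1 (32 + 20 * m) _ _ _ _ _ n) => //; try lia.
move=> M4 h17 tb4 k4.
have env4 : env M4 by apply: (env_keep env3) => z hz; apply: k4; lia.
have {e20 e21 e22 e23 e24 e25 e26 e27 e28 e29 e30 e31}
  [e20 e21 e22 e23 e24 e25 e26 e27 e28 e29 e30 e31] := env4.
apply: wp_seq; apply: (@wp_plan _ p q (m - n).+1 (32 + 20 * m) _ _ _ _ _ n m
  (32 + 19 * m)) => //; try lia.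
  by move=> r rm; rewrite k4 ?k3 ?z2 //; lia.
move=> M5 G Bd gp own5 k5.
have env5 : env M5 by apply: (env_keep env4) => z hz; apply: k5; lia.
have {e20 e21 e22 e23 e24 e25 e26 e27 e28 e29 e30 e31}
  [e20 e21 e22 e23 e24 e25 e26 e27 e28 e29 e30 e31] := env5.
apply: wp_seq; apply: (@wp_output _ m (32 + 16 * m) a b _ _ _ _ _
  (32 + 18 * m) (32 + 19 * m)) => //; try lia.
  move=> j jm; have [<- <-] := init_mem_item jm.
  rewrite !k5 ?k4 ?k3 ?k2; try lia.
  by split; [apply: h2 | rewrite -addnS h2 addnS].
move=> M6 out6 k6.
have env6 : env M6 by apply: (env_keep env5) => z hz; apply: k6; lia.
have {e20 e21 e22 e23 e24 e25 e26 e27 e28 e29 e30 e31}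
  [e20 e21 e22 e23 e24 e25 e26 e27 e28 e29 e30 e31] := env6.
apply: wp_skip; apply: wp_seq.
apply: (@wp_finish _ (32 + 18 * m)) => //; try lia.
move=> M7 M70 hM7; apply: wp_skip; rewrite /is_result nm; exists G, Bd; split=> //.
apply: read => //; first by rewrite size_map size_iota.
move=> j jm; rewrite hM7 // out6 // own5 ?rank_lt //.
by rewrite (nth_map 0) ?size_iota // nth_iota.
Qed.

End Program.

(** * Optimality *)

Import Order.TTheory GRing.Theory Num.Theory.

(** For [x > 0], rounding [x / q] up gives one more than [x.-1 %/ q]. For [p = 0] the truncated
    predecessor gives gain 0, matching rank 1 at quantile 0. *)
Lemma qrank_gain p q t : 0 < q -> qrank (rat_tau p q) t.+1 = (gain p q t).+1.
Proof.
move=> q0; have q0' : (0 < q%:R :> rat)%R by rewrite ltr0n.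
rewrite /qrank /rat_tau; have [-> | p0] := posnP p.
  by rewrite mul0r ltxx /gain mul0n div0n.
rewrite divr_gt0 ?ltr0n //.
rewrite (@ceil_def _ _ (gain p q t).+1) //.
have -> : (Posz (gain p q t).+1 - 1)%R = Posz (gain p q t) by lia.
rewrite -!pmulrn mulrAC -natrM.
rewrite ltr_pdivlMr // ler_pdivrMr // -!natrM ltr_nat ler_nat /gain.
have x0 : 0 < p * t.+1 by rewrite muln_gt0 p0.
have := divn_eq (p * t.+1).-1 q; have := ltn_mod (p * t.+1).-1 q; rewrite q0.
set c := _ %/ q; move: (_ %% q) => r; rewrite mulSn; lia.
Qed.

(** Turns quantiles into counting. In sorted order everything from position [k] on is at least the
    entry there; if that entry is below [x], so are the first [k.+1]. *)
Lemma nth_sort_ge (x : rat) (S : seq rat) k : k < size S ->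
  (x <= nth 0 (sort <=%R S) k)%R = (size S - k <= count (fun v => x <= v)%R S).
Proof.
move=> kS; have /permP <- : perm_eq (sort <=%R S) S by rewrite perm_sort.
rewrite -(size_sort <=%R S) in kS *.
have : sorted <=%R (sort <=%R S) by apply: sort_sorted; apply: le_total.
move: (sort _ _) kS => s ks ss.
have mono i j : i <= j -> j < size s -> (s`_i <= s`_j)%R.
  move=> ij js; apply: (sorted_leq_nth le_trans le_refl 0%R ss) => //.
  exact: leq_ltn_trans js.
apply/idP/idP => [le | ].
  rewrite -[X in count _ X](cat_take_drop k) count_cat.
  apply: leq_trans (leq_addl _ _); rewrite -size_drop leq_eqVlt eq_sym -all_count.
  apply/orP; left; apply/(all_nthP 0%R) => i; rewrite size_drop => hi.
  by rewrite nth_drop (le_trans le) // mono ?leq_addr // -ltn_subRL.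
apply: contraLR; rewrite -ltNge -ltnNge => lt.
rewrite -[X in count _ X](cat_take_drop k.+1) count_cat.
rewrite (_ : count _ (take _ _) = 0).
  by apply: leq_ltn_trans (count_size _ _) _; rewrite size_drop ltn_sub2l.
apply/eqP; rewrite -leqn0 leqNgt -has_count -all_predC.
apply/(all_nthP 0%R) => i; rewrite size_takel // => ik.
by rewrite /= nth_take // -ltNge (le_lt_trans _ lt) // mono.
Qed.

Lemma ESW_ge n vals tau A (x : rat) : 0 < n ->
  (forall i, i < n -> (x <= bundle_value vals tau A i)%R) ->
  (x <= ESW n vals tau A)%R.
Proof.
move=> n0 H; rewrite /ESW.
have : all (fun i => (x <= bundle_value vals tau A i)%R) (iota 0 n).
  by apply/allP => i; rewrite mem_iota => hi; apply: H.
elim: (iota 0 n) => /= [_ | i s IH /andP [hi /IH hs]]; first exact: H.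
by rewrite le_min hi.
Qed.

Lemma ESW_le n vals tau A i : i < n ->
  (ESW n vals tau A <= bundle_value vals tau A i)%R.
Proof.
move=> hi; rewrite /ESW; have : i \in iota 0 n by rewrite mem_iota.
elim: (iota 0 n) => //= j s IH; rewrite inE ge_min => /predU1P [-> | /IH ->].
  by rewrite lexx.
by rewrite orbT.
Qed.

(** The table dominates every choice of bundle sizes [(f i).+1]: by induction, the last size is one
    candidate in the maximum. *)
Lemma opt_max p q (f : nat -> nat) n :
  \sum_(i < n.+1) gain p q (f i) <= opt p q n (\sum_(i < n.+1) f i).
Proof.
elim: n => [|n IH]; first by rewrite !big_ord1.
rewrite big_ord_recr [X in opt _ _ _ X]big_ord_recr /=.
set T := \sum_(i < n.+1) f i in IH *.
have ft : f n.+1 < (T + f n.+1).+1 by rewrite ltnS leq_addl.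
apply: leq_trans (leq_bigmax (F := fun t : 'I__ =>
  opt p q n (T + f n.+1 - t) + gain p q t) (Ordinal ft)) => /=.
by rewrite addnK leq_add2r.
Qed.

Lemma sum_count_owner n (T : eqType) (P : pred T) (f : T -> nat) (s : seq T) :
  all (fun x => f x < n) s ->
  \sum_(i < n) count (fun x => P x && (f x == i)) s = count P s.
Proof.
elim: s => /= [_ | x s IH /andP [fx /IH <-]]; first by rewrite big1.
rewrite big_split /=; congr (_ + _).
rewrite (bigD1 (Ordinal fx)) //= eqxx andbT big1 ?addn0 // => i.
by rewrite -val_eqE /= eq_sym => /negbTE ->; rewrite andbF.
Qed.

Lemma sub_in_count (T : eqType) (s : seq T) (P1 P2 : pred T) :
  {in s, forall x, P1 x -> P2 x} -> count P1 s <= count P2 s.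
Proof.
move=> H; rewrite (eq_in_count (a2 := predI P1 P2)).
  by apply: sub_count => x /andP [].
by move=> x /H /=; case: (P1 x) => // ->.
Qed.

Lemma count_bundle vals A i (P : pred rat) :
  count P (bundle_vals vals A i) =
  count (fun g => P (vals`_g)%R && (nth 0 A g == i)) (iota 0 (size A)).
Proof. by rewrite count_map count_filter. Qed.

Lemma qval_nil tau : qval tau [::] = 0%R.
Proof. by rewrite /qval /= nth_nil. Qed.

(** * The order of the items by value, and their ranks *)

Section Values.
Variables (m : nat) (a b : seq nat).
Hypotheses (size_a : size a = m) (size_b : size b = m).
Hypothesis b_gt0 : all (fun d => 0 < d) b.
Let v (g : nat) : rat := ((rat_vals a b)`_g)%R.

Lemma valE g : g < m -> v g = ((nth 0 a g)%:R / (nth 0 b g)%:R)%R.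
Proof. by move=> gm; rewrite /v (nth_map 0) ?size_iota ?nth_iota ?size_a. Qed.

Lemma val_ge0 g : (0 <= v g)%R.
Proof.
have [gm | gm] := ltnP g m; first by rewrite valE // divr_ge0 ?ler0n.
by rewrite /v nth_default // size_map size_iota size_a.
Qed.

Lemma val_le i j : i < m -> j < m ->
  (v i <= v j)%R = (nth 0 a i * nth 0 b j <= nth 0 a j * nth 0 b i).
Proof.
have b0 k : k < m -> (0 < (nth 0 b k)%:R :> rat)%R.
  by move=> km; rewrite ltr0n; apply: (allP b_gt0); rewrite mem_nth ?size_b.
move=> im jm; rewrite !valE // ler_pdivrMr ?b0 // mulrAC ler_pdivlMr ?b0 //.
by rewrite -!natrM ler_nat.
Qed.

Lemma beforeE i j : i < m -> j < m ->
  before a b i j = if i < j then (v j <= v i)%R else (v j < v i)%R.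
Proof.
move=> im jm; rewrite /before ltNge !val_le // -ltnNge.
by case: (ltnP i j) => _; rewrite ?addn0 ?addn1.
Qed.

(** By transitivity, [i] and all items before it are before [j], and [i] is not before itself. *)
Lemma rank_mono i j : i < m -> j < m -> before a b i j ->
  rank a b m i < rank a b m j.
Proof.
move=> im jm bij; rewrite /rank -!size_filter.
apply: (@uniq_leq_size _ (i :: [seq k <- iota 0 m | before a b k i])).
  rewrite /= mem_filter beforeE // ltnn ltxx /=.
  by rewrite filter_uniq // iota_uniq.
move=> k; rewrite inE !mem_filter !mem_iota /= add0n => /predU1P [-> | ].
  by rewrite bij im.
move=> /andP [bki km]; rewrite km andbT.
move: bij bki; rewrite !beforeE //.
case: (ltnP i j) => ij; case: (ltnP k i) => ki h1 h2; case: (ltnP k j) => kj.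
all: try lia.
all: first [exact: le_trans h1 h2 | exact: lt_le_trans h1 h2 |
  exact: le_lt_trans h1 h2 | exact: lt_trans h1 h2 |
  exact: ltW (lt_le_trans h1 h2) | exact: ltW (le_lt_trans h1 h2) |
  exact: ltW (lt_trans h1 h2)].
Qed.

Lemma before_total i j : i < m -> j < m -> i != j ->
  before a b i j || before a b j i.
Proof.
move=> im jm ij; rewrite !beforeE //.
by case: (ltngtP i j) ij => // _ _; case: ltP; rewrite ?orbT // => /ltW.
Qed.

(** Breaking ties by index makes the order total, so ranks are distinct numbers below [m]. *)
Lemma rank_perm : perm_eq [seq rank a b m j | j <- iota 0 m] (iota 0 m).
Proof.
have u : uniq [seq rank a b m j | j <- iota 0 m].
  rewrite map_inj_in_uniq ?iota_uniq // => i j.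
  rewrite !mem_iota /= !add0n => im jm e; apply/eqP; apply: contraT => ne.
  by case/orP: (before_total im jm ne) => /rank_mono; rewrite e ltnn => ->.
apply: uniq_perm; rewrite ?iota_uniq //.
have [||//] := uniq_min_size u (s2 := iota 0 m); last by rewrite size_map.
by move=> r /mapP [j]; rewrite !mem_iota /= !add0n => jm ->; apply: rank_lt.
Qed.

Lemma count_rank (P : pred nat) :
  count (fun j => P (rank a b m j)) (iota 0 m) = count P (iota 0 m).
Proof. by rewrite -(permP rank_perm P) count_map. Qed.

Lemma rank_item r : r < m -> exists2 g, g < m & rank a b m g = r.
Proof.
move=> rm; have : r \in [seq rank a b m j | j <- iota 0 m].
  by rewrite (perm_mem rank_perm) mem_iota.
by case/mapP => g; rewrite mem_iota => gm ->; exists g.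
Qed.

Lemma val_rank_le g h : g < m -> h < m -> rank a b m g <= rank a b m h ->
  (v h <= v g)%R.
Proof.
move=> gm hm le; rewrite leNgt; apply/negP => lt.
have : before a b h g by rewrite beforeE //; case: ifP; rewrite ?ltW.
by move/(rank_mono hm gm); lia.
Qed.

Lemma val_lt_rank g h : g < m -> h < m -> (v h < v g)%R ->
  rank a b m g < rank a b m h.
Proof.
by move=> gm hm lt; rewrite ltnNge; apply/negP => /(val_rank_le hm gm); rewrite leNgt lt.
Qed.

End Values.

(** * Optimality of the planned allocation when [n <= m] *)

Section Optimality.
Variables (n m p q : nat) (a b G Bd : seq nat).
Hypotheses (n0 : 0 < n) (q0 : 0 < q) (p_le_q : p <= q) (n_le_m : n <= m).
Hypotheses (size_a : size a = m) (size_b : size b = m).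
Hypothesis b_gt0 : all (fun d => 0 < d) b.
Hypothesis planGB : good_plan p q (m - n).+1 n m G Bd.
Let v (g : nat) : rat := ((rat_vals a b)`_g)%R.
Let out : seq nat := [seq nth 0 (G ++ Bd) (rank a b m j) | j <- iota 0 m].

Lemma size_out : size out = m.
Proof. by rewrite size_map size_iota. Qed.

Lemma nth_out g : g < m -> nth 0 out g = nth 0 (G ++ Bd) (rank a b m g).
Proof. by move=> gm; rewrite (nth_map 0) ?size_iota // nth_iota. Qed.

Lemma size_plan : size (G ++ Bd) = m.
Proof. by case: planGB => h _ _ _; rewrite size_cat. Qed.

Lemma out_allocation : is_allocation n m out.
Proof.
rewrite /is_allocation size_out eqxx; apply/allP => x /mapP [g].
rewrite mem_iota add0n => /andP [_ gm] ->.
case: planGB => _ _ /allP h _; apply: h; apply: mem_nth.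
by rewrite size_plan rank_lt.
Qed.

Lemma size_G_gt0 : 0 < size G.
Proof.
case: planGB => _ _ _ /(_ 0 n0) [t _ h]; have gt := gain_le t q0 p_le_q.
by apply: leq_trans _ (count_size (pred1 0) G); lia.
Qed.

(** Suppose all bundles of [B] are worth more than [v x]. By [opt_max] at most [size Bd] items are
    not above [v x], and the items above it precede [x] in rank, so there are at most [(size G).-1]
    of them. Together these are fewer than [m]. *)
Lemma opt_out x : x < m -> rank a b m x = (size G).-1 ->
  forall B, is_allocation n m B ->
  (ESW n (rat_vals a b) (rat_tau p q) B <= v x)%R.
Proof.
move=> xm rx B /andP [/eqP sB allB]; rewrite leNgt; apply/negP => lt.
have big i : i < n -> (v x < bundle_value (rat_vals a b) (rat_tau p q) B i)%R.
  by move=> hi; apply: lt_le_trans lt (ESW_le _ _ _ hi).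
pose sz i := size (bundle_vals (rat_vals a b) B i).
pose cnt i := count (fun y => v x < y)%R (bundle_vals (rat_vals a b) B i).
(* An empty bundle has value 0, which cannot exceed [v x]. *)
have sz0 i : i < n -> 0 < sz i.
  move=> /big h; rewrite lt0n size_eq0; apply/eqP => E; move: h.
  rewrite /bundle_value E qval_nil ltNge.
  by rewrite (val_ge0 b size_a).
have cnt_ge i : i < n -> sz i <= cnt i + gain p q (sz i).-1.
  move=> hi; have := sz0 i hi; have := big i hi.
  rewrite /bundle_value /qval /sz /cnt; move: (bundle_vals _ _ _) => S.
  case E : (size S) => [//|t]; rewrite qrank_gain //= => h _.
  have gt := gain_le t q0 p_le_q.
  have gS : gain p q t < size S by rewrite E.
  have := lexx (nth 0 (sort <=%R S) (gain p q t))%R.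
  rewrite {1}(nth_sort_ge _ gS) E => h2.
  have : count (fun y => nth 0 (sort <=%R S) (gain p q t) <= y)%R S <=
         count (fun y => v x < y)%R S.
    by apply: sub_count => y /=; apply: lt_le_trans.
  by move/(leq_trans h2); rewrite leq_subLR addnC.
have aB : all (fun g => nth 0 B g < n) (iota 0 m).
  apply/allP => g; rewrite mem_iota add0n => /andP [_ gm].
  by apply: (allP allB); rewrite mem_nth ?sB.
have sum_sz : \sum_(i < n) sz i = m.
  have := sum_count_owner predT aB; rewrite count_predT size_iota => E.
  rewrite -[RHS]E; apply: eq_bigr => i _.
  by rewrite /sz -(count_predT (bundle_vals _ _ _)) count_bundle sB.
have sum_cnt : \sum_(i < n) cnt i <= (size G).-1.
  have E := sum_count_owner (fun g => v x < v g)%R aB.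
  rewrite (eq_bigr (fun i : 'I_n =>
    count (fun g => (v x < v g)%R && (nth 0 B g == i)) (iota 0 m))); last first.
    by move=> i _; rewrite /cnt count_bundle sB.
  rewrite E -rx.
  apply: (@leq_trans (count (fun g => rank a b m g < rank a b m x) (iota 0 m))).
    apply: sub_in_count => g; rewrite mem_iota add0n => /andP [_ gm].
    exact: val_lt_rank.
  rewrite (count_rank size_a size_b b_gt0 (fun r => r < rank a b m x)).
  rewrite -size_filter -[X in _ <= X](size_iota 0).
  apply: uniq_leq_size; first by rewrite filter_uniq ?iota_uniq.
  by move=> r; rewrite mem_filter !mem_iota => /andP [].
have := opt_max p q (fun i => (sz i).-1) n.-1.
rewrite prednK //.
(* [opt] counts only the items beyond the first of each bundle. *)
have -> : \sum_(i < n) (sz i).-1 = m - n.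
  have : \sum_(i < n) ((sz i).-1 + 1) = m.
    by rewrite -sum_sz; apply: eq_bigr => i _; rewrite addn1 prednK ?sz0.
  by rewrite big_split /= sum1_card card_ord => <-; rewrite addnK.
have : \sum_(i < n) sz i <= \sum_(i < n) (cnt i + gain p q (sz i).-1).
  by apply: leq_sum => i _; apply: cnt_ge.
rewrite big_split sum_sz /=.
case: planGB => h1 /= <- _ _; move: sum_cnt size_G_gt0 h1.
by move: (\sum_(i < n) cnt i) (\sum_(i < n) gain p q _) => s1 s2; lia.
Qed.

Lemma count_out i (P : pred nat) :
  count (fun g => P (rank a b m g) && (nth 0 out g == i)) (iota 0 m) =
  count (fun r => P r && (nth 0 (G ++ Bd) r == i)) (iota 0 m).
Proof.
rewrite -(count_rank size_a size_b b_gt0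
  (fun r => P r && (nth 0 (G ++ Bd) r == i))).
apply: eq_in_count => g; rewrite mem_iota add0n => /andP [_ gm].
by rewrite nth_out.
Qed.

(** [x] is the worst good item. An agent with [t.+1] items has exactly [gain p q t] bad ones, so its
    quantile item is at least as valuable as [x]. *)
Lemma out_ge x : x < m -> rank a b m x = (size G).-1 ->
  (v x <= ESW n (rat_vals a b) (rat_tau p q) out)%R.
Proof.
move=> xm rx; apply: ESW_ge => // i hi.
have [h1 _ _ /(_ i hi) [t cB cG]] := planGB; have gt := gain_le t q0 p_le_q.
have nthG k s : count (fun r => nth 0 s (r - k) == i) (iota k (size s)) =
    count_mem i s.
  elim: s k => //= y s IH k; rewrite subnn /= -(IH k.+1); congr (_ + _).
  apply: eq_in_count => r; rewrite mem_iota => hr.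
  by rewrite (_ : r - k = (r - k.+1).+1) //; lia.
have countG : count (fun r => (r < size G) && (nth 0 (G ++ Bd) r == i)) (iota 0 m)
    = count_mem i G.
  rewrite -h1 iotaD count_cat -(nthG 0 G) -[RHS]addn0; congr (_ + _).
    apply: eq_in_count => r; rewrite mem_iota add0n subn0 => /andP [_ hr].
    by rewrite hr nth_cat hr.
  rewrite add0n -(count_pred0 (iota (size G) (size Bd))); apply: eq_in_count.
  by move=> r; rewrite mem_iota => /andP [hr _]; rewrite ltnNge hr.
have countGB : count (fun r => predT r && (nth 0 (G ++ Bd) r == i)) (iota 0 m)
    = t.+1.
  rewrite -cG -cB -count_cat -(nthG 0) size_plan.
  by apply: eq_count => r; rewrite subn0.
set S := bundle_vals (rat_vals a b) out i.
have sS : size S = t.+1.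
  rewrite -countGB -count_out -(count_predT S) /S count_bundle size_out.
  by apply: eq_count.
rewrite /bundle_value -/S /qval sS qrank_gain // nth_sort_ge sS //=.
rewrite -cG addnK -countG -(count_out i (fun r => r < size G)).
rewrite /S count_bundle size_out.
apply: sub_in_count => g; rewrite mem_iota add0n => /andP [_ gm].
case/andP => hr ->; rewrite andbT.
apply: (val_rank_le size_a size_b b_gt0) => //.
by rewrite rx; lia.
Qed.

Lemma out_max : max_ESW_allocation n m (rat_vals a b) (rat_tau p q) out.
Proof.
split; first exact: out_allocation.
have [|x xm rx] := rank_item size_a size_b b_gt0 (r := (size G).-1).
  by have := size_plan; have := size_G_gt0; rewrite size_cat; lia.
move=> B hB; apply: le_trans (opt_out xm rx hB) (out_ge xm rx).
Qed.

End Optimality.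

(** By the pigeonhole principle some agent gets nothing, so no welfare exceeds 0; no welfare is
    negative either. *)
Lemma few_items n m a b tau : m < n -> size a = m ->
  max_ESW_allocation n m (rat_vals a b) tau (nseq m 0).
Proof.
move=> mn sa; split.
  by rewrite /is_allocation size_nseq eqxx all_nseq (leq_trans _ mn) ?orbT.
move=> B /andP [/eqP sB _].
have [i hi iB] : exists2 i, i < n & i \notin B.
  have /allPn [i] : ~~ all (mem B) (iota 0 n).
    apply/negP => /allP /(uniq_leq_size (iota_uniq 0 n)).
    by rewrite size_iota sB leqNgt mn.
  by rewrite mem_iota => hi iB; exists i.
apply: (@le_trans _ _ 0%R).
  apply: le_trans (ESW_le _ _ _ hi) _.
  rewrite /bundle_value /bundle_vals (_ : [seq g <- _ | _] = [::]) ?qval_nil //.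
  apply/eqP; rewrite -size_eq0 size_filter -leqn0 leqNgt -has_count.
  apply: contra iB => /hasP [g]; rewrite mem_iota add0n => /andP [_ gB] /eqP <-.
  exact: mem_nth.
apply: ESW_ge => [|j _]; first by lia.
rewrite /bundle_value /qval; set S := sort _ _; set k := _.-1.
(* The default value 0 covers the empty bundles. *)
have [kS | kS] := ltnP k (size S); last by rewrite nth_default.
have : (S`_k)%R \in S by apply: mem_nth.
rewrite mem_sort => /mapP [g _ ->]; exact: (val_ge0 b sa g).
Qed.

Lemma bitlen_le_input_size x inp : x \in inp -> bitlen x <= input_size inp.
Proof. by move=> xi; rewrite /input_size (big_rem x) //= leq_addr. Qed.

Lemma size_le_input_size inp : size inp <= input_size inp.
Proof. by rewrite -sum1_size; apply: leq_sum => x _. Qed.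

(* There is a RAM program P and a polynomial bound c*(size+1)^k such that on
   every encoded instance with identical valuations (common values a_j/b_j,
   common quantile p/q in [0,1]) P halts within the bound and outputs an
   allocation of maximum egalitarian social welfare. *)
Theorem theorem12 :
  exists (P : program) (c k : nat),
    forall (n m p q : nat) (a b : seq nat),
      0 < n -> 0 < q -> p <= q ->
      size a = m -> size b = m -> all (fun d => 0 < d) b ->
      exists (t : nat) (out : seq nat),
        t <= c * (input_size (encode_instance n m p q a b)).+1 ^ k /\
        runs_within P (encode_instance n m p q a b) t out /\
        max_ESW_allocation n m (rat_vals a b) (rat_tau p q) out.
Proof.
exists (compile 0 program_cmd), (cost_coeff program_cmd), (loop_depth program_cmd).
move=> n m p q a b n0 q0 p_le_q size_a size_b b_gt0.
set inp := encode_instance n m p q a b; set X := (input_size inp).+1.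
(* Every input number has bit length at least 1, so the input size is at least [4 + m.*2]. *)
have mX : m.*2 < X.
  have := size_le_input_size inp; rewrite size_inp /X; lia.
have item j : j < m -> nth 0 a j \in inp /\ nth 0 b j \in inp.
  move=> jm; have [<- <-] := init_mem_item n p q a b jm.
  by split; apply: mem_nth; rewrite size_inp; lia.
have aX j : j < m -> bitlen (nth 0 a j) <= X.
  by move=> /item [/bitlen_le_input_size h _]; apply: leqW.
have bX j : j < m -> bitlen (nth 0 b j) <= X.
  by move=> /item [_ /bitlen_le_input_size h]; apply: leqW.
have [t [M [t_le st res]]] :=
  wp_program n0 q0 p_le_q mX aX bX (P := compile 0 program_cmd) (o := 0)
    (fun k _ => erefl).
exists t, (read_output M); split; last split.
- by apply: leq_trans t_le (cost_poly _ _).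
- by exists M; split=> //; apply: steps_run st _; rewrite size_compile.
move: res; rewrite /is_result; case: leqP => [nm [G [Bd [gp ->]]] | mn ->].
  exact: out_max.
exact: few_items.
Qed.
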